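(* Consider the following network with the Vickrey queuing model. Nodes: $a,b,c,x,y,z,q$. Edges (free-flow time $\tau$, capacity $\nu$): $e_1=(a,b)$ with $\tau=1,\nu=1$; $e_2=(b,c)$ with $\tau=1,\nu=1$; $e_3=(c,x)$ with $\tau=\varepsilon,\nu=1$; $e_7=(y,z)$ with $\tau=1,\nu=6$; $e_5=(z,q)$ with $\tau=2-\varepsilon,\nu=2$; $e_4=(q,b)$ with $\tau=\varepsilon,\nu=2$; $e_6=(b,z)$ with $\tau=4,\nu=\infty$. Five commodities, all with value-of-time $\gamma_i=1$: commodity 1 from $y$ to $z$ with inflow rate $6\cdot\mathbf 1_{[0,1]}$; commodity 2 from $z$ to $c$ with rate $2\cdot\mathbf 1_{[2,3]}$; commodity 3 from $c$ to $x$ with rate $\mathbf 1_{[7,10+M]}$; commodity 4 from $a$ to $x$ with rate $\mathbf 1_{[4,5]}$; commodity 5 from $q$ to $b$ with rate $2\cdot\mathbf 1_{[9,13+M]}$. Then there exist values $M\in\mathbb R_{\ge0}$ such that for every $\varepsilon\in(0,1]$, no system optimal flow of this network is implementable.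
   Context: Dynamic flow model: directed graph, time horizon $H'=[0,t_f']\subseteq H=[0,t_f]$ (sufficiently large), walks $w$ (finite edge sequences, repetitions allowed) from each commodity's source to its destination, $\mathcal W_i$ the walks of commodity $i$. Edge flows $g\in L_+(H)^E$ induce traversal times $D_e(g,t)$, exit times $T_e(g,t)=t+D_e(g,t)$, and arrival times $A_{w,1}=\mathrm{id}$, $A_{w,j}(g,\cdot)=T_{w[j-1]}(g,\cdot)\circ A_{w,j-1}(g,\cdot)$. A walk flow $h\in L_+(H)^{\mathcal W}$ with $\sum_{w\in\mathcal W_i}h_w=r_i$ induces the edge flow $g=\ell(h)$ satisfying $\int_0^tg_e\,\mathrm d\sigma=\sum_w\sum_{j:w[j]=e}\int_{A_{w,j}(g,\cdot)^{-1}([0,t])}h_w\,\mathrm d\sigma$, supported on $H'$; $\Lambda$ is the set of such admissible $h$. Vickrey queuing model: $D_e(g,t)=\tau_e+q_e(g,t)/\nu_e$, where $q_e(g,t)=\int_0^tg_e\,\mathrm d\sigma-\int_{T_e(g,\cdot)^{-1}([0,t+\tau_e])}g_e\,\mathrm d\sigma$ is the queue, required to be nonnegative and with edge outflow rate (derivative of $t\mapsto\int_{T_e(g,\cdot)^{-1}([0,t])}g_e\,\mathrm d\sigma$) at most $\nu_e$ a.e.; for $\nu_e=\infty$, $D_e\equiv\tau_e$. Costs: $\Psi_{(\hat w,i)}(g,t)=\gamma_i(A_{w,|w|+1}(g,t)-t)$; for tolls $p:H\to\mathbb R_+^E$, $P^p_w(g,t)=\sum_jp_{w[j]}(A_{w,j}(g,t))$.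 $h\in\Lambda$ is a $p$-DUE if for every $i$, $w\in\mathcal W_i$ and a.e. $t$, $h_w(t)>0$ implies $\Psi_w(g,t)+P^p_w(g,t)\le\Psi_{w'}(g,t)+P^p_{w'}(g,t)$ for all $w'\in\mathcal W_i$, where $g=\ell(h)$. An edge flow $g$ is implementable if there are tolls $p\ge0$ and a $p$-DUE $h\in\Lambda$ with $\ell(h)=g$ and $\sum_e\int p_eg_e\,\mathrm d\sigma<\infty$. A system optimal flow is a minimizer of the total travel time $\sum_e\int_H D_e(g,\cdot)g_e\,\mathrm d\sigma$ over $g\in\ell(\Lambda)$. *)

(* Defs.v *)
From HB Require Import structures.
From mathcomp Require Import all_boot all_order all_algebra.
From mathcomp Require Import all_classical all_reals all_analysis.
Set Implicit Arguments.
Unset Strict Implicit.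
Unset Printing Implicit Defensive.
Import Order.TTheory GRing.Theory Num.Theory.
Import numFieldNormedType.Exports.
Local Open Scope classical_set_scope.
Local Open Scope ring_scope.

Inductive node := na | nb | nc | nx | ny | nz | nq.
Inductive edge := e1 | e2 | e3 | e4 | e5 | e6 | e7.
Inductive commodity := k1 | k2 | k3 | k4 | k5.

Definition node_nat (v : node) : nat :=
  match v with na => 0 | nb => 1 | nc => 2 | nx => 3 | ny => 4 | nz => 5 | nq => 6 end%N.
Definition nat_node (n : nat) : option node :=
  match n with 0 => Some na | 1 => Some nb | 2 => Some nc | 3 => Some nx
  | 4 => Some ny | 5 => Some nz | 6 => Some nq | _ => None end%N.
Lemma node_natK : pcancel node_nat nat_node. Proof. by case. Qed.
HB.instance Definition _ := Countable.copy node (pcan_type node_natK).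

Definition edge_nat (e : edge) : nat :=
  match e with e1 => 0 | e2 => 1 | e3 => 2 | e4 => 3 | e5 => 4 | e6 => 5 | e7 => 6 end%N.
Definition nat_edge (n : nat) : option edge :=
  match n with 0 => Some e1 | 1 => Some e2 | 2 => Some e3 | 3 => Some e4
  | 4 => Some e5 | 5 => Some e6 | 6 => Some e7 | _ => None end%N.
Lemma edge_natK : pcancel edge_nat nat_edge. Proof. by case. Qed.
HB.instance Definition _ := Countable.copy edge (pcan_type edge_natK).

Definition all_edges : seq edge := [:: e1; e2; e3; e4; e5; e6; e7].
Definition all_commodities : seq commodity := [:: k1; k2; k3; k4; k5].

Definition esrc (e : edge) : node :=
  match e with e1 => na | e2 => nb | e3 => nc | e7 => ny | e5 => nz | e4 => nq | e6 => nb end.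
Definition edst (e : edge) : node :=
  match e with e1 => nb | e2 => nc | e3 => nx | e7 => nz | e5 => nq | e4 => nb | e6 => nz end.

Definition tau {R : realType} (eps : R) (e : edge) : R :=
  match e with e1 => 1 | e2 => 1 | e3 => eps | e7 => 1 | e5 => 2 - eps
             | e4 => eps | e6 => 4 end.
(* capacities; None means nu_e = infinity *)
Definition nu {R : realType} (e : edge) : option R :=
  match e with e1 => Some 1 | e2 => Some 1 | e3 => Some 1 | e7 => Some 6
             | e5 => Some 2 | e4 => Some 2 | e6 => None end.

Definition csrc (i : commodity) : node :=
  match i with k1 => ny | k2 => nz | k3 => nc | k4 => na | k5 => nq end.
Definition cdst (i : commodity) : node :=
  match i with k1 => nz | k2 => nc | k3 => nx | k4 => nx | k5 => nb end.

Definition gamma {R : realType} (i : commodity) : R := 1.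

Definition rate {R : realType} (M : R) (i : commodity) (t : R) : R :=
  match i with
  | k1 => if (0 <= t <= 1) then 6 else 0
  | k2 => if (2 <= t <= 3) then 2 else 0
  | k3 => if (7 <= t <= 10 + M) then 1 else 0
  | k4 => if (4 <= t <= 5) then 1 else 0
  | k5 => if (9 <= t <= 13 + M) then 2 else 0
  end.

Fixpoint chain (w : seq edge) : bool :=
  match w with
  | e :: ((e' :: _) as w') => (edst e == esrc e') && chain w'
  | _ => true
  end.

Definition is_walk (s d : node) (w : seq edge) : bool :=
  [&& w != [::], esrc (head e1 w) == s, edst (last e1 w) == d & chain w].

Definition walks (i : commodity) : set (seq edge) :=
  [set w | is_walk (csrc i) (cdst i) w].

Definition leb {R : realType} := (@lebesgue_measure R).

Definition Rint {R : realType} (A : set R) (f : R -> R) : R :=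
  fine (\int[leb]_(s in A) (f s)%:E)%E.

(* representatives of elements of L_+(H), H = [0,tf] *)
Definition Lplus {R : realType} (tf : R) (f : R -> R) : Prop :=
  (forall t, 0 <= f t) /\
  (forall t, ~ (0 <= t <= tf) -> f t = 0) /\
  leb.-integrable [set: R] (EFin \o f).

(* D is the traversal-time function of an edge with free-flow time ta and
   capacity n (None = infinity) under edge inflow ge *)
Definition vickrey_ok {R : realType} (ta : R) (n : option R) (ge : R -> R)
    (D : R -> R) : Prop :=
  match n with
  | None => forall t, D t = ta
  | Some nu_e =>
      let T := fun s => s + D s in
      let Out := fun t : R => Rint [set s | 0 <= T s <= t] ge in
      let q := fun t : R => Rint [set s | 0 <= s <= t] ge - Out (t + ta) in
      (forall t, D t = ta + q t / nu_e) /\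
      (forall t, 0 <= q t) /\
      {ae leb, forall t, derivable Out t 1 /\ derive1 Out t <= nu_e}
  end.

(* D_e(g, .) : the Vickrey traversal time (chosen among the functions
   satisfying the defining conditions; it is unique in the model) *)
Definition Dtime {R : realType} (eps : R) (g : edge -> R -> R) (e : edge) : R -> R :=
  xget (fun _ => tau eps e) [set D | vickrey_ok (tau eps e) (nu e) (g e) D].

Definition Texit {R : realType} (eps : R) (g : edge -> R -> R) (e : edge) (t : R) : R :=
  t + Dtime eps g e t.

(* arrival time at the (j+1)-th edge of w (0-indexed j; arr .. 0 t = t);
   arr .. (size w) t is the arrival time at the destination.
   This is A_{w,j+1}(g,t) of the paper. *)
Definition arr {R : realType} (eps : R) (g : edge -> R -> R) (w : seq edge) (j : nat)
    (t : R) : R :=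
  foldl (fun s e => Texit eps g e s) t (take j w).

Definition walk_flow_ok {R : realType} (M tf : R)
    (h : commodity -> seq edge -> R -> R) : Prop :=
  (forall i w, w \in walks i -> Lplus tf (h i w)) /\
  (forall i w, ~ (w \in walks i) -> forall t, h i w t = 0) /\
  (forall i, {ae leb, forall t,
     (\esum_(w in walks i) (h i w t)%:E = (rate M i t)%:E)%E}).

Definition induces {R : realType} (eps : R) (h : commodity -> seq edge -> R -> R)
    (g : edge -> R -> R) : Prop :=
  forall (e : edge) (t : R),
    (\int[leb]_(s in [set s : R | (0 <= s <= t)%R]) (g e s)%:E =
     \sum_(i <- all_commodities)
       \esum_(w in walks i)
         \sum_(j < size w | nth e1 w j == e)
           \int[leb]_(s in [set s : R | (0 <= arr eps g w j s <= t)%R]) (h i w s)%:E)%E.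

Definition feasible {R : realType} (eps M tf' tf : R)
    (h : commodity -> seq edge -> R -> R) (g : edge -> R -> R) : Prop :=
  walk_flow_ok M tf h /\
  (forall e, Lplus tf (g e)) /\
  (forall e t, ~ (0 <= t <= tf') -> g e t = 0) /\
  induces eps h g.

Definition in_image {R : realType} (eps M tf' tf : R) (g : edge -> R -> R) : Prop :=
  exists h, feasible eps M tf' tf h g.

Definition Psi {R : realType} (eps : R) (g : edge -> R -> R) (i : commodity)
    (w : seq edge) (t : R) : R :=
  gamma i * (arr eps g w (size w) t - t).

Definition Ptoll {R : realType} (eps : R) (g : edge -> R -> R) (p : edge -> R -> R)
    (w : seq edge) (t : R) : R :=
  \sum_(j < size w) p (nth e1 w j) (arr eps g w j t).

Definition DUE_cond {R : realType} (eps : R) (p : edge -> R -> R)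
    (h : commodity -> seq edge -> R -> R) (g : edge -> R -> R) : Prop :=
  forall i w, w \in walks i ->
    {ae leb, forall t, 0 < h i w t ->
       forall w', w' \in walks i ->
         Psi eps g i w t + Ptoll eps g p w t <= Psi eps g i w' t + Ptoll eps g p w' t}.

Definition implementable {R : realType} (eps M tf' tf : R) (g : edge -> R -> R) : Prop :=
  exists p : edge -> R -> R,
    (forall e t, 0 <= p e t) /\
    exists h, feasible eps M tf' tf h g /\ DUE_cond eps p h g /\
      (\sum_(e <- all_edges)
          \int[leb]_(s in [set s : R | (0 <= s <= tf)%R]) (p e s * g e s)%:E < +oo)%E.

Definition total_time {R : realType} (eps tf : R) (g : edge -> R -> R) : \bar R :=
  (\sum_(e <- all_edges)
     \int[leb]_(s in [set s : R | (0 <= s <= tf)%R]) (Dtime eps g e s * g e s)%:E)%E.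

Definition system_optimal {R : realType} (eps M tf' tf : R) (g : edge -> R -> R) : Prop :=
  in_image eps M tf' tf g /\
  forall g', in_image eps M tf' tf g' -> (total_time eps tf g <= total_time eps tf g')%E.

(* Main.v *)
(* A tolled equilibrium never sends commodity 1 further than the single edge e7,
   since tolls are nonnegative and every longer walk reaches z strictly later.
   Then commodity 2 leaves e5 without queueing and, in flows in which it takes
   its direct walk, fills e2 exactly when commodity 4 wants to use it. So a
   volume 1 is late: it is either still around on e3, where it delays the
   saturating commodity 3, or circulates through e4, where it delays commodity
   5. Together with the free-flow volume 3 eps on e3 and e4 this keeps a volume
   at least 1 + 3 eps on the network throughout [11, 10 + M], so the total
   travel time is at least (1 + 3 eps) (M - 1).
   Sending commodity 1 through the loop e5, e4, e6 instead delays commodity 2 by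
   a queue on e5, no volume is late, and the total travel time is at most
   69 + 20 eps + 3 eps M. For M = 100 the second value is smaller. *)
From HB Require Import structures.
From mathcomp Require Import all_boot all_order all_algebra.
From mathcomp Require Import all_classical all_reals all_analysis.
From mathcomp Require Import measurable_realfun.
From mathcomp Require Import ring lra.
Set Implicit Arguments.
Unset Strict Implicit.
Unset Printing Implicit Defensive.
Import Order.TTheory GRing.Theory Num.Theory.
Import numFieldNormedType.Exports.
Require Import Defs.
Local Open Scope classical_set_scope.
Local Open Scope ring_scope.

(** * A single Vickrey edge *)

(** [Dtime] is picked by [xget] from conditions that constrain the outflow only through an almost
    everywhere bound on its derivative, so nothing can be computed from it directly. Both bounds
    rest on the explicit formula [tau + queue / nu], where [queue] is a supremum of inflow minus
    capacity over past intervals. The uniqueness behind this formula requires the outflow to be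
    absolutely continuous, since an almost everywhere derivative bound alone admits jumps and
    singular growth. Absolute continuity holds because the exit time has positive derivative at
    almost every entry time with positive inflow, so that a null set of exit times receives no
    volume. The lower bound never determines the equilibrium. The walks of commodities 2 to 5 stay
    arbitrary, loops included: each arrival is charged to a passage through e3 or e4, whose capacity
    limits such passages. The equilibrium condition serves only to fix the walk of commodity 1. *)

Lemma negligible_expanding (R : realType) (N P : set R) (phi : R -> R) (c : R) :
  0 < c -> leb.-negligible N -> (forall s, P s -> N (phi s)) ->
  (forall r s, P r -> P s -> c * `|r - s| <= `|phi r - phi s|) ->
  leb.-negligible P.
Proof.
move=> c0 /negligible_outer_measure N0 PN Pc.
apply/negligible_outer_measure/eqP.
set l := (_^*)%mu in N0 *.
rewrite eq_le outer_measure_ge0 andbT.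
apply/lee_addgt0Pr => e e0; rewrite add0e.
(* The part of [P] sent into an interval of length [l] lies within [l / c] of any of its points, so
   its outer measure is at most [2 * l / c]. A cover of [N] of total length [e * (c / 2)] therefore
   yields [e]. *)
have [F [Fitv NF] Fe] : exists2 F, open_itv_cover N F &
    (\sum_(0 <= k <oo) wlength idfun (F k) <= (e * (c / 2))%:E)%E.
  have ec0 : 0 < e * (c / 2) by rewrite mulr_gt0// divr_gt0.
  have : l N \is a fin_num by rewrite N0.
  rewrite /l outer_measure_open_itv_cover => /(lb_ereal_inf_adherent ec0).
  rewrite -outer_measure_open_itv_cover -/l N0 add0e => -[_ [F NF <-] /ltW ?].
  by exists F.
pose Q k := P `&` phi @^-1` F k.
have PQ : P `<=` \bigcup_k Q k.
  by move=> s Ps; have [k _ Fk] := NF _ (PN _ Ps); exists k.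
have wF k : (0 <= wlength idfun (F k))%E.
  have [[a b] /= ->] := Fitv k; rewrite wlength_itv/=; case: ifPn => //.
  by rewrite lte_fin -EFinB lee_fin subr_ge0 => /ltW.
have lQ k : (l (Q k) <= (2 / c)%:E * wlength idfun (F k))%E.
  have [[a b] /= Fk] := Fitv k.
  have [->|/set0P[p [Pp Fp]]] := eqVneq (Q k) set0.
    by rewrite -[l _]/(lebesgue_measure _) measure0 mule_ge0// lee_fin ltW// divr_gt0.
  have ab : a < b by move: Fp; rewrite /= Fk/= in_itv/= => /andP[] /lt_trans; exact.
  have Qsub : Q k `<=` `[p - (b - a) / c, p + (b - a) / c].
    move=> s [Ps]; rewrite /= Fk/= !in_itv/= => /andP[as_ sb].
    move: Fp; rewrite /= Fk/= in_itv/= => /andP[ap pb].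
    rewrite -ler_distlC ler_pdivlMr// mulrC (le_trans (Pc _ _ Pp Ps))//.
    by rewrite ler_norml; lra.
  have cab : 0 < (b - a) / c by rewrite divr_gt0// subr_gt0.
  apply: (@le_trans _ _ (leb `[p - (b - a) / c, p + (b - a) / c]%classic)).
    exact: (@le_mu_ext _ _ _ (wlength idfun) _ _ Qsub).
  rewrite /leb lebesgue_measure_itv/= lte_fin Fk wlength_itv/= lte_fin ab.
  have -> : p - (b - a) / c < p + (b - a) / c by lra.
  rewrite -!EFinD -EFinM lee_fin; rewrite le_eqVlt; apply/orP; left; apply/eqP; field; exact: lt0r_neq0.
apply: (le_trans (@le_mu_ext _ _ _ (wlength idfun) _ _ PQ)).
apply: (le_trans (outer_measure_sigma_subadditive lebesgue_measure Q)).
apply: (@le_trans _ _ (\sum_(0 <= k <oo) ((2 / c)%:E * wlength idfun (F k)))%E).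
  by apply: lee_nneseries => // k _ _; exact: outer_measure_ge0.
rewrite nneseriesZl; last by move=> *; exact: wF.
apply: (@le_trans _ _ ((2 / c)%:E * (e * (c / 2))%:E)%E).
  by rewrite lee_pmul2l// lte_fin divr_gt0.
by rewrite -EFinM lee_fin; rewrite le_eqVlt; apply/orP; left; apply/eqP; field; exact: lt0r_neq0.
Qed.

(** A single natural number bounds both the radius and the constant, so that the expanding points
    form a countable union. *)
Definition expanding_at (R : realType) (T : R -> R) (s : R) : Prop :=
  exists n : nat, forall r, `|r - s| < n.+1%:R^-1 ->
    n.+1%:R^-1 * `|r - s| <= `|T r - T s|.

Lemma negligible_preimage_expanding (R : realType) (T : R -> R) (N E : set R) :
  leb.-negligible N -> {ae leb, forall s, E s -> expanding_at T s} ->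
  leb.-negligible (T @^-1` N `&` E).
Proof.
move=> N0 Eexp.
(* The index [k] codes one grid cell of width [n.+1%:R^-1]. Two points of the same cell lie within
   each other's radius, so [T] expands uniformly on [P n k]. *)
pose P (n k : nat) : set R := [set s | [/\ N (T s),
  (forall r, `|r - s| < n.+1%:R^-1 -> n.+1%:R^-1 * `|r - s| <= `|T r - T s|) &
  unpickle k = Some (Num.floor (s * n.+1%:R))]].
have P0 n k : leb.-negligible (P n k).
  apply: (@negligible_expanding R N (P n k) T n.+1%:R^-1) => //.
  - by move=> s [].
  move=> r s [_ _ rk] [_ sexp sk]; apply: sexp.
    have n0 : 0 < n.+1%:R :> R by [].
    have [kE] : Some (Num.floor (r * n.+1%:R)) = Some (Num.floor (s * n.+1%:R)).
      by rewrite -rk -sk.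
    have /andP[r1 r2] := floor_itv (r * n.+1%:R).
    have /andP[s1 s2] := floor_itv (s * n.+1%:R).
    rewrite kE intrD in r1 r2; rewrite intrD in s2.
    rewrite -[_^-1]mul1r ltr_pdivlMr// -[X in _ * X](gtr0_norm n0) -normrM mulrBl.
    rewrite ltr_norml; move: r1 r2 s1 s2.
    set x := r * _; set y := s * _; set z := _%:~R; rewrite /=.
    by move=> *; apply/andP; split; lra.
apply: negligibleS (negligibleU Eexp (negligible_bigcup (fun n => negligible_bigcup (P0 n)))).
move=> s [NTs Es]; have [[n nexp]|nexp] := pselect (expanding_at T s).
  right; exists n => //; exists (pickle (Num.floor (s * n.+1%:R))) => //.
  by split => //; rewrite pickleK.
by left => /= /(_ Es).
Qed.

Lemma integrable_measurable_fun (R : realType) (f : R -> R) :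
  leb.-integrable [set: R] (EFin \o f) -> measurable_fun [set: R] f.
Proof. by case/integrableP => /measurable_EFinP. Qed.

Section pushforward_density.
Context {R : realType} (g T : R -> R).
Hypotheses (g0 : forall s, 0 <= g s)
  (intg : leb.-integrable [set: R] (EFin \o g))
  (mT : measurable_fun [set: R] T).

Definition push_charge (A : set (measurableTypeR R)) : \bar R :=
  (\int[leb]_(s in T @^-1` A) (g s)%:E)%E.

Let mTpre (A : set R) : measurable A -> measurable (T @^-1` A).
Proof. by move=> mA; rewrite -[X in measurable X]setTI; exact: mT. Qed.

Let push_charge0 : push_charge set0 = 0%E.
Proof. by rewrite /push_charge preimage_set0 integral_set0. Qed.

Let push_charge_finite A : measurable A -> push_charge A \is a fin_num.
Proof.
move=> mA; apply: integrable_fin_num => //; first exact: mTpre.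
by apply: integrableS intg => //; exact: mTpre.
Qed.

Let push_charge_sigma_additive : semi_sigma_additive push_charge.
Proof.
move=> F mF tF mUF; rewrite /push_charge preimage_bigcup.
have := @charge_semi_sigma_additive _ _ _ (induced_charge intg) (fun k => T @^-1` F k).
apply => //; first by move=> k; exact: (mTpre (mF k)).
- move=> i j _ _ [s [Fi Fj]]; apply: tF => //.
  by exists (T s).
- by rewrite -preimage_bigcup; exact: (mTpre mUF).
Qed.

HB.instance Definition _ := isCharge.Build _ _ _ push_charge
  push_charge0 push_charge_finite push_charge_sigma_additive.

(** Up to points with [g s = 0], the preimage of a null set under [T] is null, so the image of [g]
    under [T] is dominated by Lebesgue measure and has a Radon-Nikodym density. *)
Lemma pushforward_density :
  {ae leb, forall s, 0 < g s -> expanding_at T s} ->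
  exists2 f : R -> R, leb.-integrable [set: R] (EFin \o f) &
    forall A : set R, measurable A ->
      (\int[leb]_(s in T @^-1` A) (g s)%:E = \int[leb]_(s in A) (f s)%:E)%E.
Proof.
move=> gexp.
have dom : push_charge `<< (@leb R).
  apply/null_content_dominatesP => A mA A0.
  have /negligible_preimage_expanding/(_ gexp) [N [mN N0 subN]] : leb.-negligible A.
    by exists A; split.
  have mTA : measurable (T @^-1` A) by exact: (mTpre mA).
  rewrite /push_charge (ge0_negligible_integral mN mTA)//=; last 2 first.
  - apply/measurable_EFinP; apply: measurable_funTS.
    exact: integrable_measurable_fun.
  - by move=> s _; rewrite lee_fin.
  rewrite integral0_eq// => s [TsA sN]; congr EFin; apply/eqP.
  by rewrite eq_le g0 andbT leNgt; apply/negP => gs0; apply: sN; exact: subN.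
have fin x : Radon_Nikodym push_charge (@leb R) x \is a fin_num.
  exact: Radon_Nikodym_fin_num.
have fE : EFin \o (fine \o Radon_Nikodym push_charge (@leb R)) =
    Radon_Nikodym push_charge (@leb R).
  by apply/funext => x /=; rewrite fineK.
exists (fine \o Radon_Nikodym push_charge (@leb R)).
  by rewrite fE; exact: Radon_Nikodym_integrable.
move=> A mA; rewrite -[LHS]/(push_charge A) (Radon_Nikodym_integral dom)//.
by apply: eq_integral => x _; rewrite -[RHS]/((EFin \o (fine \o _)) x) fE.
Qed.

End pushforward_density.

Lemma aeS (R : realType) (P Q : R -> Prop) : (forall s, P s -> Q s) ->
  {ae leb, forall s, P s} -> {ae leb, forall s, Q s}.
Proof. by move=> PQ; apply: negligibleS => s /= + /PQ. Qed.

Lemma aeI (R : realType) (P Q : R -> Prop) : {ae leb, forall s, P s} ->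
  {ae leb, forall s, Q s} -> {ae leb, forall s, P s /\ Q s}.
Proof.
move=> nP nQ; apply: negligibleS (negligibleU nP nQ) => s /=.
by move=> /not_andP.
Qed.

(** * Masses of sets and cumulative functions *)

Section mass.
Context {R : realType} (g : R -> R).
Hypothesis g0 : forall s, 0 <= g s.
Implicit Types A B : set R.

(** Over any set, measurable or not, the nonnegative integral is a supremum over simple functions
    below the patched integrand, and this family grows with the set. *)
Lemma le_mass A B : A `<=` B ->
  (\int[leb]_(s in A) (g s)%:E <= \int[leb]_(s in B) (g s)%:E)%E.
Proof.
move=> AB; rewrite !ge0_integralE//; try by move=> *; rewrite lee_fin.
apply: ereal_sup_le => _ [h hA <-]; exists h => // s.
apply: le_trans (hA s) _; rewrite !patchE.
case: ifPn => sA; last by case: ifPn => // _; rewrite lee_fin.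
by rewrite ifT//; move: sA; rewrite !inE; exact: AB.
Qed.

Lemma mass_ge0 A : (0 <= \int[leb]_(s in A) (g s)%:E)%E.
Proof. by apply: integral_ge0 => s _; rewrite lee_fin. Qed.

Lemma eq_mass A B : (forall s, g s != 0 -> A s <-> B s) ->
  (\int[leb]_(s in A) (g s)%:E = \int[leb]_(s in B) (g s)%:E)%E.
Proof.
move=> AB; rewrite integral_mkcond [RHS]integral_mkcond; apply: eq_integral => s _.
rewrite !patchE; have [->|gs] := eqVneq (g s) 0; first by case: ifP; case: ifP.
suff -> : (s \in A) = (s \in B) by [].
by apply/idP/idP; rewrite !inE => /(AB _ gs).
Qed.

Hypothesis intg : leb.-integrable [set: R] (EFin \o g).

Lemma mass_fin A : (\int[leb]_(s in A) (g s)%:E)%E \is a fin_num.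
Proof.
rewrite ge0_fin_numE ?mass_ge0//; apply: le_lt_trans (le_mass (@subsetT _ A)) _.
by rewrite -ge0_fin_numE ?mass_ge0//; exact: integrable_fin_num.
Qed.

Lemma EFin_Rint A : ((Rint A g)%:E = \int[leb]_(s in A) (g s)%:E)%E.
Proof. by rewrite /Rint fineK// mass_fin. Qed.

Lemma Rint_ge0 A : 0 <= Rint A g.
Proof. by rewrite -lee_fin EFin_Rint mass_ge0. Qed.

Lemma le_Rint A B : A `<=` B -> Rint A g <= Rint B g.
Proof. by move=> AB; rewrite -lee_fin !EFin_Rint le_mass. Qed.

Lemma eq_Rint A B : (forall s, g s != 0 -> A s <-> B s) -> Rint A g = Rint B g.
Proof. by move=> AB; rewrite /Rint (eq_mass AB). Qed.

End mass.

Lemma derivable_expanding (R : realType) (T : R -> R) (s d : R) :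
  is_derive s (1 : R) T d -> d != 0 -> expanding_at T s.
Proof.
move=> [/cvg_ex[/= l Tl] dTs] d0.
have ld : l = d by rewrite -dTs; apply/esym/cvg_lim.
rewrite {}ld in Tl; have nd0 : 0 < `|d| / 2 by rewrite divr_gt0// normr_gt0.
have [e e0 eT] : exists2 e : R, 0 < e & forall h, `|h| < e -> h != 0 ->
    `|d| / 2 <= `|h^-1 * (T (h + s) - T s)|.
  move/cvgrPdist_lt : Tl => /(_ _ nd0) [e /= e0 eT]; exists e => // h he h0.
  have := eT h; rewrite /ball_/= sub0r normrN => /(_ he h0).
  rewrite /GRing.scale/= mulr1 => dT.
  have := ler_normD (d - h^-1 * (T (h + s) - T s)) (h^-1 * (T (h + s) - T s)).
  by rewrite subrK => ?; lra.
have m0 : 0 < Num.min e (`|d| / 2) by rewrite lt_min e0.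
have [n] := near_infty_natSinv_lt (PosNum m0).
rewrite /= => _ /(_ n (leqnn n)) /=; rewrite lt_min => /andP[ne nd].
exists n => r rs; have [->|rs0] := eqVneq r s; first by rewrite !subrr normr0 mulr0.
have h0 : r - s != 0 by rewrite subr_eq0.
have := eT (r - s) (lt_trans rs ne) h0.
rewrite subrK normrM normfV ler_pdivlMl ?normr_gt0// => /(le_trans _); apply.
by rewrite mulrC ler_wpM2l// ltW.
Qed.

(** Integrating from [-oo] gives a function on the whole line to which the fundamental theorem of
    calculus applies. For inflows that vanish at negative times, [cumul_Icc] identifies it with the
    integral from 0. *)
Definition cumul {R : realType} (g : R -> R) (t : R) : R := Rint `]-oo, t] g.

Section cumul.
Context {R : realType} (g : R -> R).
Hypotheses (g0 : forall s, 0 <= g s)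
  (intg : leb.-integrable [set: R] (EFin \o g)).

Lemma cumul_nd : {homo cumul g : a b / a <= b}.
Proof.
move=> a b ab; apply: le_Rint => // s; rewrite /= !in_itv/= => /le_trans; exact.
Qed.

Lemma cumul_ge0 t : 0 <= cumul g t. Proof. exact: Rint_ge0. Qed.

Lemma cumul_derive : {ae leb, forall t : R, is_derive t (1 : R) (cumul g) (g t)}.
Proof.
have intgS y : leb.-integrable `]-oo, y] (EFin \o g).
  by apply: integrableS intg.
have locg : locally_integrable [set: R] g.
  by apply: open_integrable_locally => //; exact: openT.
apply: aeS (FTC1Ny intgS locg) => t [dt <-].
split; first exact: dt.
by rewrite -derive1E.
Qed.

End cumul.

Lemma leb_oc (R : realType) (a b : R) : a <= b -> leb `]a, b] = (b - a)%:E.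
Proof.
move=> ab; rewrite /leb lebesgue_measure_itv/= lte_fin -EFinB; case: ltP => // ba.
have -> : a = b by apply/eqP; rewrite eq_le ab ba.
by rewrite subrr.
Qed.

Lemma ae_shift (R : realType) (P : R -> Prop) (c : R) :
  {ae leb, forall s, P s} -> {ae leb, forall s, P (s + c)}.
Proof.
move=> nP; apply: (@negligible_expanding _ _ _ (fun s => s + c) 1) nP _ _ => //.
by move=> r s _ _; rewrite mul1r (_ : r + c - (s + c) = r - s)//; ring.
Qed.

Lemma Rint_itv_ae_le (R : realType) (f : R -> R) (n a b : R) :
  leb.-integrable [set: R] (EFin \o f) -> {ae leb, forall s, f s <= n} ->
  a <= b -> Rint `]-oo, b] f - Rint `]-oo, a] f <= n * (b - a).
Proof.
move=> intf fn ab.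
have intS (A : set R) : measurable A -> leb.-integrable A (EFin \o f).
  by move=> mA; apply: integrableS intf.
have mf := integrable_measurable_fun intf.
rewrite [X in X <= _](@Rintegral_itvB R f -oo%O (BRight b))//; last exact: intS.
have muab := leb_oc ab.
have mcn : measurable_fun [set: R] (cst n) by exact: measurable_cst.
(* The truncation agrees with [f] almost everywhere and satisfies the bound at every point, as
   monotonicity of the integral requires. *)
pose f2 s := Num.min (f s) n.
have intn : leb.-integrable `]a, b] (EFin \o cst n).
  apply/integrableP; split; first exact/measurable_EFinP/measurable_cst.
  rewrite (eq_integral (cst `|n|%:E))// integral_cst//.
  by rewrite [X in (_ * X)%E]muab -EFinM ltry.
have intf2 : leb.-integrable `]a, b] (EFin \o f2).
  have intfn : leb.-integrable `]a, b] (EFin \o (fun s => `|f s| + `|n|)).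
    apply: (@integrableD _ _ _ leb _ _ (abse \o (EFin \o f)) (abse \o (EFin \o cst n))) => //.
    + by apply: integrable_abse; exact: intS.
    + exact: integrable_abse.
  apply: le_integrable intfn => //.
  + by apply/measurable_EFinP/measurable_funTS; exact: measurable_minr.
  + move=> s _; rewrite /= lee_fin [leRHS]ger0_norm ?addr_ge0// /f2.
    by case: (leP (f s) n) => _; rewrite ?lerDl ?lerDr ?normr_ge0.
rewrite [X in X <= _](_ : _ = Rint `]a, b] f2).
  rewrite (_ : n * (b - a) = \int[leb]_(x in `]a, b]) cst n x).
    apply: le_Rintegral => // s _; rewrite /f2; by case: (leP (f s) n).
  by rewrite Rintegral_cst// [X in fine X]muab.
rewrite /Rint; congr fine; apply: ae_eq_integral => //.
- by apply/measurable_EFinP; exact: measurable_funTS.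
- by apply/measurable_EFinP; apply: measurable_funTS; exact: measurable_minr.
- by apply: negligibleS fn => s /= + fsn; apply => _; rewrite /f2 min_l.
Qed.

(** * Absolute continuity of the outflow *)

Section vickrey_edge.
Context {R : realType} (g D : R -> R) (ta n : R).
Hypotheses (g0 : forall s, 0 <= g s)
  (intg : leb.-integrable [set: R] (EFin \o g))
  (gneg : forall s, s < 0 -> g s = 0)
  (ta0 : 0 < ta) (n0 : 0 < n) (VD : vickrey_ok ta (Some n) g D).

Let T s := s + D s.
Let Out t := Rint [set s | 0 <= T s <= t] g.
Let q t := cumul g t - Out (t + ta).

Lemma cumul_Icc t : Rint [set s | 0 <= s <= t] g = cumul g t.
Proof.
apply: eq_Rint => // s gs; rewrite /= in_itv/=; split=> [/andP[]//|->].
by rewrite andbT leNgt; apply/negP => /gneg/eqP; rewrite (negbTE gs).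
Qed.

Let DE t : D t = ta + q t / n.
Proof. by case: VD => /(_ t) -> _; rewrite cumul_Icc. Qed.

Let q0 t : 0 <= q t.
Proof. by case: VD => _ [/(_ t) + _]; rewrite cumul_Icc. Qed.

Let TE t : T t = t + ta + q t / n.
Proof. by rewrite /T DE addrA. Qed.

Let T_ge t : t + ta <= T t.
Proof. by rewrite TE lerDl divr_ge0// ltW. Qed.

Let Out_nd : {homo Out : a b / a <= b}.
Proof.
move=> a b ab; apply: le_Rint => // s /= /andP[-> /= /le_trans]; exact.
Qed.

Let mT : measurable_fun [set: R] T.
Proof.
rewrite (_ : T = (fun t => t + ta + (cumul g t - Out (t + ta)) / n)); last exact/funext/TE.
apply: measurable_funD; first exact: measurable_funD.
apply: measurable_funM => //; apply: measurable_funB.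
  by apply: nondecreasing_measurable => //; exact: cumul_nd.
by apply: nondecreasing_measurable => // a b ab; apply: Out_nd; rewrite lerD2r.
Qed.

(** Almost everywhere [T] has derivative [1 + (g s - o) / n] with outflow rate [o <= n], which is at
    least [g s / n]. *)
Let T_expanding : {ae leb, forall s, 0 < g s -> expanding_at T s}.
Proof.
case: VD => _ [_ /(ae_shift ta) Oder].
move: (aeI (cumul_derive intg) Oder); apply: aeS => s [Gs [dO O'n]] gs0.
pose o := 'D_1 Out (s + ta).
have dOs : is_derive (s + ta) (1 : R) Out o by split.
have on : o <= n by rewrite /o -derive1E.
apply: (@derivable_expanding _ _ _ (1 + (g s - o) / n)); last first.
  rewrite gt_eqF// -(divff (lt0r_neq0 n0)) -mulrDl divr_gt0//; lra.
have idD : is_derive s (1 : R) (id \+ cst ta) (1 + 0) by exact: is_deriveD.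
have shD : is_derive s (1 : R) (+%R^~ ta) 1.
  by rewrite -[X in is_derive _ _ _ X]addr0.
have OD : is_derive s (1 : R) (Out \o (+%R^~ ta)) (o * 1) by exact: is_derive1_comp.
have := is_deriveD idD (is_deriveZ n^-1 (is_deriveB Gs OD)).
rewrite addr0 mulr1 [n^-1 *: _]mulrC.
suff -> : T = id \+ cst ta + n^-1 \*: (cumul g - (Out \o +%R^~ ta)) by [].
by apply/funext => t; rewrite TE mulrC.
Qed.

(** This writes [Out] as the integral of a density. The density is almost everywhere the derivative
    of [Out], so the capacity bound can be integrated in [vickrey_out_lip]. *)
Lemma vickrey_out_density : exists2 f : R -> R,
  leb.-integrable [set: R] (EFin \o f) & Out = cumul f.
Proof.
have [f intf fE] := pushforward_density g0 intg mT T_expanding.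
exists f => //; apply/funext => t; rewrite /cumul /Rint -fE//; congr fine.
apply: eq_mass => // s gs; rewrite /= in_itv/=; split=> [/andP[]//|->].
rewrite andbT; have s0 : 0 <= s.
  by rewrite leNgt; apply/negP => /gneg/eqP; rewrite (negbTE gs).
by apply: le_trans (T_ge s); rewrite addr_ge0// ltW.
Qed.

Lemma vickrey_out_lip a b : a <= b -> Out b - Out a <= n * (b - a).
Proof.
move=> ab; have [f intf OutE] := vickrey_out_density.
rewrite OutE; apply: Rint_itv_ae_le => //.
case: VD => _ [_ OD].
have := aeI OD (cumul_derive intf); apply: aeS => s [[_ +] [_ fs]].
by rewrite -[X in X^`()%classic]/Out OutE derive1E fs.
Qed.

End vickrey_edge.

(** * Queue and exit time as explicit functions of the inflow *)

Lemma cumul_unif_cont (R : realType) (g : R -> R) (e : R) :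
  (forall s, 0 <= g s) -> leb.-integrable [set: R] (EFin \o g) -> 0 < e ->
  exists2 d, 0 < d & forall a b, a <= b -> b - a < d -> cumul g b - cumul g a < e.
Proof.
move=> g0 intg e0; have [d [d0 gd]] := integral_normr_continuous intg e0.
exists d => // a b ab bad; have mab : measurable `]a, b]%classic by [].
have := gd `]a, b]%classic mab; rewrite [X in (X < _)%E](leb_oc ab).
rewrite lte_fin => /(_ bad); apply: le_lt_trans; rewrite le_eqVlt; apply/orP; left; apply/eqP.
rewrite [LHS](@Rintegral_itvB R g -oo%O (BRight b))//; last by apply: integrableS intg.
by apply: eq_Rintegral => s _; rewrite ger0_norm.
Qed.

Lemma cumul_itvo (R : realType) (g : R -> R) (t : R) :
  leb.-integrable [set: R] (EFin \o g) -> Rint `]-oo, t[ g = cumul g t.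
Proof.
move=> intg; rewrite /cumul /Rint integral_itv_bndo_bndc//.
by apply/measurable_EFinP/measurable_funTS; exact: integrable_measurable_fun.
Qed.

(** The reflection formula for a server of rate [n]: the supremum is attained at the start of the
    current busy period, and [s = t] accounts for an empty queue. *)
Definition queue {R : realType} (g : R -> R) (n t : R) : R :=
  sup [set cumul g t - cumul g s - n * (t - s) | s in `]-oo, t]].

Section queue.
Context {R : realType} (g : R -> R) (n : R).
Hypotheses (g0 : forall s, 0 <= g s)
  (intg : leb.-integrable [set: R] (EFin \o g)) (n0 : 0 < n).

Let G := cumul g.
Let Gnd a b : a <= b -> G a <= G b. Proof. exact: cumul_nd. Qed.

Lemma queue_ub t s : s <= t -> G t - G s - n * (t - s) <= queue g n t.
Proof.
move=> st; apply: ub_le_sup; last by exists s => //; rewrite /= in_itv.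
exists (G t) => x [r /=]; rewrite in_itv/= => rt <-.
have : 0 <= n * (t - r) by rewrite mulr_ge0 ?subr_ge0// ltW.
by have := cumul_ge0 g0 intg r; rewrite /G; lra.
Qed.

Lemma queue_le t b :
  (forall s, s <= t -> G t - G s - n * (t - s) <= b) -> queue g n t <= b.
Proof.
move=> tb; apply: ge_sup; first by exists (G t - G t - n * (t - t)), t => //=; rewrite in_itv/=.
by move=> x [r /=]; rewrite in_itv/= => rt <-; exact: tb.
Qed.

Lemma queue_ge0 t : 0 <= queue g n t.
Proof. by have := queue_ub (lexx t); rewrite !subrr mulr0 subr0. Qed.

Lemma queue_grow a b : a <= b ->
  queue g n a + (G b - G a) - n * (b - a) <= queue g n b.
Proof.
move=> ab.
suff : queue g n a <= queue g n b - (G b - G a) + n * (b - a) by move=> ?; lra.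
apply: queue_le => s sa; have := queue_ub (le_trans sa ab).
by move=> ?; lra.
Qed.

Lemma queue_drop a b : a <= b -> queue g n b <= queue g n a + (G b - G a).
Proof.
move=> ab; apply: queue_le => s sb; have [sa|/ltW as_] := leP s a.
  have := queue_ub sa; have : 0 <= n * (b - a) by rewrite mulr_ge0 ?subr_ge0// ltW.
  by move=> ? ?; lra.
have := queue_ge0 a; have := Gnd as_.
have : 0 <= n * (b - s) by rewrite mulr_ge0 ?subr_ge0// ltW.
by move=> ? ? ?; lra.
Qed.

End queue.

Section exit_time.
Context {R : realType} (g : R -> R) (n ta : R).
Hypotheses (g0 : forall s, 0 <= g s)
  (intg : leb.-integrable [set: R] (EFin \o g))
  (gneg : forall s, s < 0 -> g s = 0)
  (n0 : 0 < n) (ta0 : 0 < ta).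

Definition exit_time t := t + (ta + queue g n t / n).
Let T := exit_time.

Lemma exit_time_ge t : t + ta <= T t.
Proof. by rewrite /T/exit_time addrA lerDl divr_ge0 ?queue_ge0// ltW. Qed.

(** After dividing [queue_grow] by [n], the term [b - a] cancels against the elapsed time. The
    result is the capacity bound in terms of entry times, and it contains the first-in-first-out
    property. *)
Lemma exit_time_grow a b : a <= b -> (cumul g b - cumul g a) / n <= T b - T a.
Proof.
move=> ab; have := queue_grow g0 intg n0 ab.
rewrite -(ler_pM2r (_ : 0 < n^-1)) ?invr_gt0// 2!mulrDl mulNr.
by rewrite mulrAC divff ?gt_eqF// mul1r /T/exit_time !mulrBl => ?; lra.
Qed.

Lemma exit_time_nd : {homo T : a b / a <= b}.
Proof.
move=> a b ab; rewrite -subr_ge0; apply: le_trans (exit_time_grow ab).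
by rewrite divr_ge0 ?subr_ge0 ?cumul_nd// ltW.
Qed.

Lemma exit_time_le a b : a <= b ->
  T b - T a <= (b - a) + (cumul g b - cumul g a) / n.
Proof.
move=> ab; have := queue_drop g0 intg n0 ab.
rewrite -(ler_pM2r (_ : 0 < n^-1)) ?invr_gt0// !mulrDl mulNr /T/exit_time => ?; lra.
Qed.

Lemma exit_time_unif_cont e : 0 < e ->
  exists2 d, 0 < d & forall a b, a <= b -> b - a < d -> T b - T a < e.
Proof.
move=> e0; have e20 : 0 < e / 2 * n by rewrite mulr_gt0 ?divr_gt0.
have [d d0 Gd] := cumul_unif_cont g0 intg e20.
exists (Num.min d (e / 2)); first by rewrite lt_min d0 divr_gt0.
move=> a b ab; rewrite lt_min => /andP[/(Gd _ _ ab) + be].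
rewrite -ltr_pdivrMr// => Ge; apply: le_lt_trans (exit_time_le ab) _; lra.
Qed.

Lemma cumul_neg t : t < 0 -> cumul g t = 0.
Proof.
move=> t0; rewrite /cumul /Rint integral0_eq// => s /=; rewrite in_itv/= => st.
by rewrite gneg// (le_lt_trans st).
Qed.

Lemma exit_time_neg t : t < 0 -> T t = t + ta.
Proof.
move=> t0; rewrite /T/exit_time (_ : queue g n t = 0) ?mul0r ?addr0//.
apply/eqP; rewrite eq_le queue_ge0// andbT; apply: queue_le => // s st.
have : 0 <= n * (t - s) by rewrite mulr_ge0 ?subr_ge0// ltW.
by rewrite (cumul_neg t0); have := cumul_ge0 g0 intg s => ? ?; lra.
Qed.

(** The witness is the last entry time from which the edge is left by [t]; continuity makes it exit
    exactly at [t]. Thus the volume that has left by [t] is the volume that entered by [x]. *)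
Lemma exit_time_inv t : exists2 x, T x = t & forall s, (T s <= t) = (s <= x).
Proof.
pose A := [set s | T s <= t].
(* Before time 0 there is no queue, so a negative entry time at most [t - ta] exits by [t]. *)
have A0 : A (Num.min (- 1) (t - ta)).
  rewrite /A/= exit_time_neg ?gt_min ?ltrN10//.
  by rewrite -lerBrDr ge_min lexx orbT.
have At : ubound A t.
  by move=> s As; apply: le_trans (le_trans (exit_time_ge s) As); rewrite lerDl ltW.
have supA : has_sup A by split; [exists (Num.min (- 1) (t - ta))|exists t].
have Tx : T (sup A) = t.
  apply/eqP; rewrite eq_le !leNgt; apply/andP; split; apply/negP => Tt.
    have e0 : 0 < T (sup A) - t by rewrite subr_gt0.
    have [d d0 Td] := exit_time_unif_cont e0.
    have [s As sA] := sup_adherent d0 supA.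
    have sx : s <= sup A by apply: ub_le_sup => //; exists t.
    have /(Td _ _ sx) : sup A - s < d by lra.
    by move: As; rewrite /A/= => ? ?; lra.
  have e0 : 0 < t - T (sup A) by rewrite subr_gt0.
  have [d d0 Td] := exit_time_unif_cont e0.
  have xd : sup A <= sup A + d / 2 by rewrite lerDl divr_ge0// ltW.
  have : sup A + d / 2 - sup A < d by lra.
  move=> /(Td _ _ xd) Txd.
  have : A (sup A + d / 2) by rewrite /A/=; lra.
  move=> /(@ub_le_sup _ _ (ex_intro _ t At)); lra.
exists (sup A) => // s; apply/idP/idP => sA; first by apply: ub_le_sup => //; exists t.
by rewrite -Tx exit_time_nd.
Qed.

End exit_time.

Lemma derive_le_lip (R : realType) (F : R -> R) (t d n : R) :
  (forall a b, a <= b -> F b - F a <= n * (b - a)) ->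
  is_derive t (1 : R) F d -> d <= n.
Proof.
move=> Flip [dF <-]; apply: limr_le => //.
near=> h; rewrite /GRing.scale/= mulr1.
have h0 : h != 0 by near: h; exact: nbhs_dnbhs_neq.
rewrite mulrC; have [hp|hn] := ltP 0 h.
  have tht : t <= h + t by rewrite lerDr ltW.
  by rewrite ler_pdivrMr//; have := Flip _ _ tht; rewrite addrK.
have hn0 : h < 0 by rewrite lt_neqAle hn andbT.
have tht : h + t <= t by rewrite gerDr.
by rewrite ler_ndivrMr//; have := Flip _ _ tht => ?; lra.
Unshelve. all: by end_near. Qed.

(** * Uniqueness and existence of the traversal time *)

Section vickrey_unique.
Context {R : realType} (g : R -> R) (ta n : R).
Hypotheses (g0 : forall s, 0 <= g s)
  (intg : leb.-integrable [set: R] (EFin \o g))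
  (gneg : forall s, s < 0 -> g s = 0)
  (ta0 : 0 < ta) (n0 : 0 < n).

Let G := cumul g.

(** The Lipschitz bound on [Out] makes [q t] at least every term of the supremum. Equality is
    reached at the start of the busy period that contains [t]. *)
Lemma vickrey_ok_queue D : vickrey_ok ta (Some n) g D ->
  forall t, D t = ta + queue g n t / n.
Proof.
move=> VD.
pose T s := s + D s.
pose Out t := Rint [set s | 0 <= T s <= t] g.
pose q t := G t - Out (t + ta).
have DE t : D t = ta + q t / n by case: VD => /(_ t) -> _; rewrite cumul_Icc.
have q0 t : 0 <= q t by case: VD => _ [/(_ t) + _]; rewrite cumul_Icc.
have TE t : T t = t + ta + q t / n by rewrite /T DE addrA.
have lip a b : a <= b -> Out b - Out a <= n * (b - a) by exact: vickrey_out_lip VD _ _.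
have Tge s : s + ta <= T s by rewrite TE lerDl divr_ge0// ltW.
have s_ge0 s : g s != 0 -> 0 <= s.
  by move=> gs; rewrite leNgt; apply/negP => /gneg/eqP; rewrite (negbTE gs).
have Tnd a b : a <= b -> T a <= T b.
  move=> ab; rewrite !TE; have ab' : a + ta <= b + ta by rewrite lerD2r.
  have := lip _ _ ab'; have : G a <= G b by exact: cumul_nd.
  move=> Gab Oab; have : q a - n * (b - a) <= q b by rewrite /q; lra.
  rewrite -(ler_pM2r (_ : 0 < n^-1)) ?invr_gt0// mulrBl mulrAC divff ?gt_eqF// mul1r.
  by move=> ?; lra.
suff qE t : q t = queue g n t by move=> t; rewrite DE qE.
apply/eqP; rewrite eq_le; apply/andP; split; last first.
  apply: queue_le => // s st; have st' : s + ta <= t + ta by rewrite lerD2r.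
  by have := lip _ _ st'; have := q0 s; rewrite /q /G => ? ?; lra.
have qneg s : s < 0 -> q s = 0.
  move=> sn; apply/eqP; rewrite eq_le q0 andbT /q /G cumul_neg// sub0r oppr_le0.
  exact: Rint_ge0.
have [tn|t0] := ltP t 0; first by rewrite qneg ?queue_ge0.
(* On [S] the server works at full rate until [t]; its left end has no queue. *)
pose S := [set s | 0 <= s <= t /\ n * (t - s) <= Out (t + ta) - Out (s + ta)].
have St : S t by split; rewrite ?t0 ?lexx// !subrr mulr0.
have S0 : lbound S 0 by move=> s [/andP[]].
have infS : has_inf S by split; [exists t|exists 0].
have s00 : 0 <= inf S by apply: lb_le_inf; [exists t|].
have s0t : inf S <= t by apply: ge_inf => //; exists 0.
have SinfS : S (inf S).
  split; first by rewrite s00.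
  rewrite leNgt; apply/negP => Olt.
  set e := n * (t - inf S) - (Out (t + ta) - Out (inf S + ta)).
  have e0 : 0 < e / n by rewrite divr_gt0// subr_gt0.
  have [s Ss si] := inf_adherent e0 infS.
  have is_ : inf S <= s by apply: ge_inf => //; exists 0.
  have [_ sS] := Ss; have := si; rewrite -ltrBlDl ltr_pdivlMr// mulrC => si'.
  have ist : inf S + ta <= s + ta by rewrite lerD2r.
  have : Out (inf S + ta) <= Out (s + ta).
    by apply: le_Rint => // r /= /andP[-> /le_trans]; exact.
  by move: si' sS; rewrite /e => *; lra.
have qinf : q (inf S) = 0.
  apply/eqP; rewrite eq_le q0 andbT leNgt; apply/negP => qi.
  (* If every entry before [inf S] had left by [inf S + ta], then [Out] would have caught up with
     [G] there. For an [s] that has not, the outflow during [[s + ta, T s]] is at least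
     [q s = n * (T s - s - ta)], the full rate, so [s] belongs to [S] although [s < inf S]. *)
  have [s si Ts] : exists2 s, s < inf S & inf S + ta < T s.
    apply: contrapT => nex; move: qi; rewrite ltNge => /negP; apply.
    rewrite subr_le0 /G -cumul_itvo//.
    rewrite (@eq_Rint _ _ _ [set s | 0 <= s /\ s < inf S]); last first.
      move=> s gs; rewrite /= in_itv/=; split=> [?|[]//].
      by split => //; exact: s_ge0.
    apply: le_Rint => // s [s0 si].
    have Ts0 : 0 <= T s by apply: le_trans (Tge s); rewrite addr_ge0// ltW.
    by rewrite /= Ts0 leNgt; apply/negP => Ts; apply: nex; exists s.
  have s0 : 0 <= s.
    rewrite leNgt; apply/negP => sn; move: Ts.
    by rewrite TE qneg// mul0r addr0 ltrD2r ltNge ltW.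
  have OTs : G s <= Out (T s).
    rewrite /G -cumul_Icc//; apply: le_Rint => // r /= /andP[r0 rs].
    by rewrite Tnd// andbT (le_trans _ (Tge r))// addr_ge0// ltW.
  have sit : s <= t by apply: le_trans s0t; exact: ltW.
  have := lip _ _ (ltW Ts); have nT : n * T s = n * s + n * ta + q s.
    by rewrite TE !mulrDr [n * (_ / n)]mulrC divfK// gt_eqF.
  rewrite mulrBr nT => lipT; move: si; rewrite ltNge => /negP; apply.
  apply: ge_inf; first by exists 0.
  have [_ iS] := SinfS; split; first by rewrite s0.
  by move: lipT iS OTs; rewrite /q => *; lra.
have [_ iS] := SinfS.
apply: le_trans (queue_ub g0 intg n0 s0t).
by move: qinf iS; rewrite /q -/G => *; lra.
Qed.

(** Existence is needed as well as uniqueness: if no function met the conditions, [xget] would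
    return its default, the free-flow time. *)
Lemma queue_vickrey_ok : vickrey_ok ta (Some n) g (fun t => ta + queue g n t / n).
Proof.
pose T := exit_time g n ta.
have Tge s : s + ta <= T s by exact: exit_time_ge.
have Tnd : {homo T : a b / a <= b} by exact: exit_time_nd.
have mT : measurable_fun [set: R] T by exact: nondecreasing_measurable.
have Texp : {ae leb, forall s, 0 < g s -> expanding_at T s}.
  have := cumul_derive intg; apply: aeS => s Gs gs.
  have [k kG] := derivable_expanding Gs (lt0r_neq0 gs).
  have TG r : `|cumul g r - cumul g s| / n <= `|T r - T s|.
    wlog rs : r s {Gs gs kG} / r <= s.
      have [rs|/ltW sr] := leP r s; first exact.
      by rewrite distrC [leRHS]distrC; exact.
    rewrite distrC [leRHS]distrC !ger0_norm ?subr_ge0 ?Tnd ?cumul_nd//.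
    exact: exit_time_grow.
  have [m nm] : exists m, n < m.+1%:R.
    exists (Num.truncn n); exact: truncnS_gt.
  (* The inverse of [k.+1 * m.+1] is at most the radius found for [cumul g], and at most the
     constant found there divided by [n]. *)
  exists ((k.+1 * m.+1).-1)%N; rewrite prednK// natrM => r rs.
  have m1 : 1 <= m.+1%:R :> R by rewrite ler1n.
  have rk : `|r - s| < k.+1%:R^-1.
    apply: lt_le_trans rs _; rewrite lef_pV2 ?posrE ?mulr_gt0//.
    by rewrite ler_peMr.
  apply: le_trans (TG r); rewrite invfM mulrAC; apply: ler_pM.
  - by rewrite mulr_ge0 ?invr_ge0.
  - by rewrite invr_ge0.
  - exact: kG.
  - by rewrite lef_pV2 ?posrE// ltW.
have [f intf fE] := pushforward_density g0 intg mT Texp.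
pose Out t := Rint [set s | 0 <= T s <= t] g.
have s_ge0 s : g s != 0 -> 0 <= s.
  by move=> gs; rewrite leNgt; apply/negP => /gneg/eqP; rewrite (negbTE gs).
have OutT t : Out t = Rint (T @^-1` `]-oo, t]) g.
  apply: eq_Rint => // s gs; rewrite /= in_itv/=; split=> [/andP[]//|->].
  by rewrite andbT; apply: le_trans (Tge s); rewrite addr_ge0 ?(ltW ta0) ?s_ge0.
have OutE : Out = cumul f by apply/funext => t; rewrite OutT /Rint fE.
(* With [x] the last entry that has left by [t + ta], the queue met at [x] is [n * (t - x)], exactly
   what is served until [t]; hence what entered after [x] is the queue at [t]. *)
have Outq t : Out (t + ta) = G t - queue g n t.
  have [x Tx xP] := exit_time_inv g0 intg gneg n0 ta0 (t + ta).
  rewrite OutT (_ : _ @^-1` _ = `]-oo, x]%classic); last first.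
    by apply/seteqP; split => s; rewrite /= !in_itv/= xP.
  rewrite -/(cumul g x) -/G.
  have xt : x <= t by have := Tge x; rewrite /T Tx lerD2r.
  have qx : queue g n x = n * (t - x).
    have : queue g n x / n = t - x by move: Tx; rewrite /exit_time => ?; lra.
    by move/(congr1 ( *%R n)) => <-; rewrite [RHS]mulrC divfK// gt_eqF.
  apply/eqP; rewrite eq_le; apply/andP; split.
    rewrite lerBrDr -lerBrDl; apply: queue_le => // r rt; rewrite -/G.
    have [rx|/ltW xr] := leP r x.
      by have := queue_ub g0 intg n0 rx; rewrite qx -/G => ?; lra.
    have : G x <= G r by exact: cumul_nd.
    have : 0 <= n * (t - r) by rewrite mulr_ge0 ?subr_ge0// ltW.
    by move=> ? ?; lra.
  by have := queue_grow g0 intg n0 xt; rewrite qx -/G => ?; lra.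
split; first by move=> t; rewrite cumul_Icc// -/(Out (t + ta)) Outq -/G subKr.
split; first by move=> t; rewrite cumul_Icc// -/(Out (t + ta)) Outq -/G subKr queue_ge0.
suff : {ae leb, forall t, derivable (cumul f) t 1 /\ derive1 (cumul f) t <= n}.
  by rewrite -OutE.
have := cumul_derive intf; apply: aeS => t dt; split; first by case: dt.
rewrite derive1E; case: (dt) => _ ->; rewrite -OutE in dt.
apply: derive_le_lip dt => a b ab; rewrite -(subrK ta a) -(subrK ta b) !Outq.
have ab' : a - ta <= b - ta by rewrite lerD2r.
by have := queue_grow g0 intg n0 ab'; rewrite -/G => ?; lra.
Qed.

End vickrey_unique.

(** * Arrival times along walks *)

Lemma DtimeE (R : realType) (eps : R) (g : edge -> R -> R) (e : edge) (n : R) :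
  (forall s, 0 <= g e s) -> leb.-integrable [set: R] (EFin \o g e) ->
  (forall s, s < 0 -> g e s = 0) -> 0 < tau eps e -> 0 < n -> nu e = Some n ->
  forall t, Dtime eps g e t = tau eps e + queue (g e) n t / n.
Proof.
move=> g0 intg gneg ta0 n0 nue; apply: vickrey_ok_queue => //.
rewrite /Dtime nue; apply: xgetPex.
by exists (fun t => tau eps e + queue (g e) n t / n); exact: queue_vickrey_ok.
Qed.

Definition flow {R : realType} (g : edge -> R -> R) : Prop := forall e,
  [/\ forall s, 0 <= g e s, leb.-integrable [set: R] (EFin \o g e) &
      forall s, s < 0 -> g e s = 0].

Section Texit.
Context {R : realType} (eps : R) (g : edge -> R -> R).
Hypotheses (eps01 : 0 < eps <= 1) (fg : flow g).

Lemma tau_gt0 e : 0 < tau eps e.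
Proof. by case/andP: eps01 => ? ?; case: e => /=; lra. Qed.

Lemma nu_gt0 e (n : R) : nu e = Some n -> 0 < n.
Proof. by case: e => //= -[<-]. Qed.

Lemma TexitE e n : nu e = Some n ->
  Texit eps g e = exit_time (g e) n (tau eps e).
Proof.
move=> nue; apply/funext => t; have [g0 intg gneg] := fg e.
by rewrite /Texit (DtimeE g0 intg gneg (tau_gt0 e) (nu_gt0 nue) nue).
Qed.

Lemma Texit6 t : Texit eps g e6 t = t + 4.
Proof.
rewrite /Texit /Dtime; congr (_ + _).
suff : [set D | vickrey_ok (tau eps e6) (nu e6) (g e6) D] (Dtime eps g e6) by exact.
by apply: xgetPex; exists (fun=> 4).
Qed.

Lemma Texit_ge e t : t + tau eps e <= Texit eps g e t.
Proof.
have [g0 intg gneg] := fg e.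
case nue : (nu e : option R) => [n|].
  by rewrite (TexitE nue); apply: exit_time_ge => //; exact: nu_gt0 nue.
by case: e nue {g0 intg gneg} => // _; rewrite Texit6.
Qed.

Lemma Texit_nd e : {homo Texit eps g e : a b / a <= b}.
Proof.
have [g0 intg gneg] := fg e.
case nue : (nu e : option R) => [n|].
  by rewrite (TexitE nue); apply: exit_time_nd => //; exact: nu_gt0 nue.
by case: e nue {g0 intg gneg} => // _ a b ab; rewrite !Texit6 lerD2r.
Qed.

Lemma Texit_inv e t :
  exists2 x, Texit eps g e x = t & forall s, (Texit eps g e s <= t) = (s <= x).
Proof.
have [g0 intg gneg] := fg e.
case nue : (nu e : option R) => [n|].
  rewrite (TexitE nue); apply: exit_time_inv => //; first exact: nu_gt0 nue.
  exact: tau_gt0.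
case: e nue {g0 intg gneg} => // _; exists (t - 4); first by rewrite Texit6 subrK.
by move=> s; rewrite Texit6 lerBrDr.
Qed.

(** If no past interval ending at [t] brought more than the capacity, every term of the supremum is
    at most 0. *)
Lemma Texit_noqueue e n t : nu e = Some n ->
  (forall s, s <= t -> cumul (g e) t - cumul (g e) s <= n * (t - s)) ->
  Texit eps g e t = t + tau eps e.
Proof.
move=> nue gt; have [g0 intg gneg] := fg e.
rewrite (TexitE nue) /exit_time (_ : queue _ _ _ = 0) ?mul0r ?addr0//.
apply/eqP; rewrite eq_le queue_ge0//; last exact: nu_gt0 nue.
by rewrite andbT; apply: queue_le => // s st; rewrite subr_le0 gt.
Qed.

Definition outflow e t := Rint [set s | Texit eps g e s <= t] (g e).

Lemma outflowE e x t : (forall s, (Texit eps g e s <= t) = (s <= x)) ->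
  outflow e t = cumul (g e) x.
Proof.
move=> xP; rewrite /outflow /cumul; congr Rint.
by apply/seteqP; split=> s; rewrite /= in_itv/= xP.
Qed.

Lemma outflow_le e n a b : nu e = Some n -> a <= b ->
  outflow e b <= outflow e a + n * (b - a).
Proof.
move=> nue ab; have [g0 intg gneg] := fg e; have n0 := nu_gt0 nue.
have [x Tx xP] := Texit_inv e a; have [y Ty yP] := Texit_inv e b.
rewrite (outflowE xP) (outflowE yP).
have xy : x <= y by rewrite -yP Tx.
have := exit_time_grow (tau eps e) g0 intg n0 xy.
rewrite -(TexitE nue) Tx Ty ler_pdivrMr// => ?; lra.
Qed.

Lemma measurable_Texit e : measurable_fun [set: R] (Texit eps g e).
Proof. by apply: nondecreasing_measurable => //; exact: Texit_nd. Qed.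

Lemma arrS w j s : (j < size w)%N ->
  arr eps g w j.+1 s = Texit eps g (nth e1 w j) (arr eps g w j s).
Proof. by move=> jw; rewrite /arr (take_nth e1)// foldl_rcons. Qed.

Lemma arr_nd w j : {homo arr eps g w j : a b / a <= b}.
Proof.
rewrite /arr; elim: (take j w) => //= e {}w IH a b ab.
by apply: IH; exact: Texit_nd.
Qed.

Lemma arr_ge w j s : s + \sum_(e <- take j w) tau eps e <= arr eps g w j s.
Proof.
rewrite /arr; elim: (take j w) s => [|e {}w IH] s /=; first by rewrite big_nil addr0.
rewrite big_cons addrA; apply: le_trans (IH _).
by rewrite lerD2r Texit_ge.
Qed.

Lemma arr_le w j k s : (j <= k)%N -> arr eps g w j s <= arr eps g w k s.
Proof.
move=> jk; rewrite -(subnKC jk); set m := (k - j)%N.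
have -> : arr eps g w (j + m) s = arr eps g (drop j w) m (arr eps g w j s).
  by rewrite /arr takeD foldl_cat.
apply: le_trans (arr_ge _ _ _); rewrite lerDl.
by apply: sumr_ge0 => e _; exact: ltW (tau_gt0 e).
Qed.

Lemma measurable_arr w j : measurable_fun [set: R] (arr eps g w j).
Proof. by apply: nondecreasing_measurable => //; exact: arr_nd. Qed.

End Texit.

(** * Sums over countably many walks *)

Lemma esum_pickle (R : realType) (T : countType) (A : set T) (a : T -> \bar R) :
  (forall x, A x -> 0 <= a x)%E ->
  (\esum_(x in A) a x =
   \sum_(0 <= n <oo)
     (if @pickle_inv T n is Some x then (if x \in A then a x else 0) else 0))%E.
Proof.
move=> a0; rewrite esum_mkcond.
set b := fun x => if x \in A then a x else 0%E.
have b0 x : (0 <= b x)%E by rewrite /b; case: ifPn => //; rewrite inE; exact: a0.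
pose c n : \bar R := if @pickle_inv T n is Some x then b x else 0%E.
have c0 n : (0 <= c n)%E by rewrite /c; case: (@pickle_inv T n).
rewrite -[RHS]/(\sum_(0 <= n <oo) c n)%E nneseries_esumT//.
rewrite [RHS](esumID (range (@pickle T))) ?setTI//.
rewrite [X in (_ + X)%E]esum1 ?adde0; last first.
  move=> n /= nr; rewrite /c; case E : (@pickle_inv T n) => [x|//].
  by case: nr; exists x => //; have := @pickle_invK T n; rewrite E.
rewrite esum_image; last by move=> x y _ _ /(pcan_inj (@pickleK_inv T)).
by apply: eq_esum => x _; rewrite /c pickleK_inv.
Qed.

(** Enumerating the index type by its codes turns the sum into a series, for which monotone
    convergence is available. *)
Lemma integral_esum (R : realType) (T : countType) (A : set T) (D : set R)
    (f : T -> R -> \bar R) : measurable D ->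
  (forall x, A x -> measurable_fun D (f x)) ->
  (forall x s, A x -> 0 <= f x s)%E ->
  (\int[leb]_(s in D) (\esum_(x in A) f x s) = \esum_(x in A) (\int[leb]_(s in D) f x s))%E.
Proof.
move=> mD mf f0.
rewrite esum_pickle; last by move=> x Ax; apply: integral_ge0 => s _; exact: f0.
transitivity (\int[leb]_(s in D) (\sum_(0 <= n <oo)
    (if @pickle_inv T n is Some x then (if x \in A then f x s else 0) else 0)))%E.
  by apply: eq_integral => s _; rewrite esum_pickle// => x; exact: f0.
rewrite integral_nneseries//; first last.
- move=> n s _; case: (@pickle_inv T n) => // x; case: ifPn => //; rewrite inE; exact: f0.
- move=> n; case: (@pickle_inv T n) => [x|]; last exact: measurable_cst.
  case: (boolP (x \in A)) => [|_]; last exact: measurable_cst.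
  by rewrite inE; exact: mf.
apply: eq_eseriesr => n _; case: (@pickle_inv T n) => [x|]; last by rewrite integral0.
by case: (boolP (x \in A)) => // _; rewrite integral0.
Qed.

Lemma esum_ge1 (R : realType) (T : choiceType) (A : set T) (a : T -> \bar R) x :
  A x -> (a x <= \esum_(y in A) a y)%E.
Proof.
move=> Ax; apply: esum_ge; exists [set x]; last by rewrite fsbig_set1.
by split; [exact: finite_set1|move=> y ->].
Qed.

Lemma esum_pick (R : realType) (T : choiceType) (A : set T) (x : T) (a : \bar R) :
  A x -> (0 <= a)%E -> (\esum_(y in A) (if y == x then a else 0) = a)%E.
Proof.
move=> Ax a0; rewrite (esumID [set x]); last by move=> y _; case: ifP.
rewrite (_ : A `&` [set x] = [set x]); last by apply/seteqP; split=> [y []//|y ->].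
rewrite esum_set1 ?eqxx// esum1 ?adde0// => y [_ /= yx].
by case: eqP.
Qed.

(** Measurability is at hand for [B] only, so [A] is first enlarged to the union of [B], the zero
    set of [f] and the exceptional null set. *)
Lemma ge0_mass_ae_le (R : realType) (f : R -> R) (A B : set R) :
  (forall s, 0 <= f s) -> measurable_fun [set: R] f -> measurable B ->
  {ae leb, forall s, A s -> f s != 0 -> B s} ->
  (\int[leb]_(s in A) (f s)%:E <= \int[leb]_(s in B) (f s)%:E)%E.
Proof.
move=> f0 mf mB [N [mN N0 subN]].
pose Z := f @^-1` [set 0].
have mZ : measurable Z.
  by rewrite -[X in measurable X]setTI; apply: mf => //; exact: measurable_set1.
have mE : measurable (B `|` Z) by exact: measurableU.
have le1 : (\int[leb]_(s in A) (f s)%:E <=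
    \int[leb]_(s in (B `|` Z) `|` N) (f s)%:E)%E.
  apply: le_mass => // s As; have [Bs|nBs] := pselect (B s); first by left; left.
  have [fs|fs] := eqVneq (f s) 0; first by left; right.
  by right; apply: subN => /= /(_ As fs).
apply: le_trans le1 _.
rewrite (ge0_negligible_integral mN)//=; last 3 first.
- exact: measurableU.
- by apply/measurable_EFinP; exact: measurable_funTS.
- by move=> s _; rewrite lee_fin.
rewrite [leRHS](_ : _ = \int[leb]_(s in B `|` Z) (f s)%:E)%E.
  by apply: le_mass => // s [[]].
apply: eq_mass => // s fs; split=> [Bs|[//|]]; first by left.
by rewrite /Z/= => /eqP; rewrite (negbTE fs).
Qed.

Lemma ae_neq (R : realType) (a : R) : {ae leb, forall s, s != a}.
Proof.
exists [set a]; split; [exact: measurable_set1|exact: lebesgue_measure_set1|].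
by move=> s /= /negP; rewrite negbK => /eqP.
Qed.

(** * Conservation of volume *)

Definition netsum {R : realType} (F : commodity -> seq edge -> \bar R) : \bar R :=
  (\sum_(i <- all_commodities) \esum_(w in walks i) F i w)%E.

Section netsum.
Context {R : realType}.
Implicit Types F : commodity -> seq edge -> \bar R.

Lemma eq_netsum F F' : (forall i w, walks i w -> F i w = F' i w) ->
  netsum F = netsum F'.
Proof. by move=> FF; apply: eq_bigr => i _; apply: eq_esum => w; exact: FF. Qed.

Lemma le_netsum F F' : (forall i w, walks i w -> F i w <= F' i w)%E ->
  (netsum F <= netsum F')%E.
Proof. by move=> FF; apply: lee_sum => i _; apply: le_esum => w; exact: FF. Qed.

Lemma netsumD F F' : (forall i w, 0 <= F i w)%E -> (forall i w, 0 <= F' i w)%E ->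
  netsum (fun i w => F i w + F' i w)%E = (netsum F + netsum F')%E.
Proof.
move=> F0 F'0; rewrite /netsum -big_split/=; apply: eq_bigr => i _.
by rewrite esumD.
Qed.

Lemma netsum_ge0 F : (forall i w, 0 <= F i w)%E -> (0 <= netsum F)%E.
Proof. by move=> F0; apply: sume_ge0 => i _; apply: esum_ge0 => w _; exact: F0. Qed.

Lemma netsum_sum (I : Type) (r : seq I) (F : I -> commodity -> seq edge -> \bar R) :
  (forall k i w, 0 <= F k i w)%E ->
  netsum (fun i w => \sum_(k <- r) F k i w)%E = (\sum_(k <- r) netsum (F k))%E.
Proof.
move=> F0; elim: r => [|k r IH].
  rewrite big_nil; rewrite /netsum big1// => i _.
  by apply: esum1 => w _; rewrite big_nil.
rewrite big_cons -IH -netsumD//; last by move=> i w; exact: sume_ge0.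
by apply: eq_netsum => i w _; rewrite big_cons.
Qed.

End netsum.

(* The volume of commodity [i] on the walk [w] that has entered its [j]-th edge
   (its destination if [j = size w]) by time [t]. *)
Definition passed {R : realType} (eps : R) (h : commodity -> seq edge -> R -> R)
    (g : edge -> R -> R) (i : commodity) (w : seq edge) (j : nat) (t : R) : \bar R :=
  (\int[leb]_(s in [set s | (arr eps g w j s <= t)%R]) (h i w s)%:E)%E.

Section walk_flow.
Context {R : realType} (eps M tf' tf : R)
  (h : commodity -> seq edge -> R -> R) (g : edge -> R -> R).
Hypotheses (eps01 : 0 < eps <= 1) (fhg : feasible eps M tf' tf h g).

Lemma feasible_flow : flow g.
Proof.
case: fhg => _ [Lg _] e; have [g0 [gz intg]] := Lg e; split => // s s0.
by apply: gz => /andP[]; rewrite leNgt s0.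
Qed.

Lemma walk_flow i w : [/\ forall s, 0 <= h i w s,
  leb.-integrable [set: R] (EFin \o h i w) & forall s, s < 0 -> h i w s = 0].
Proof.
case: fhg => -[Lh [hz _]] _; have [wi|wi] := pselect (w \in walks i).
  have [h0 [h_z inth]] := Lh i w wi; split => // s s0.
  by apply: h_z => /andP[]; rewrite leNgt s0.
have -> : h i w = cst 0 by apply/funext => s; exact: hz.
by split => //; exact: integrable0.
Qed.

Let fg := feasible_flow.

Local Notation passed := (passed eps h g).

Lemma passed_ge0 i w j t : (0 <= passed i w j t)%E.
Proof. by apply: mass_ge0; case: (walk_flow i w). Qed.

Lemma le_passed i w j k a b : (j <= k)%N -> a <= b ->
  (passed i w k a <= passed i w j b)%E.
Proof.
move=> jk ab; apply: le_mass; first by case: (walk_flow i w).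
by move=> s /= /(le_trans (arr_le eps01 fg w s jk)) /le_trans; exact.
Qed.

Lemma passed0 i w t : passed i w 0 t = (cumul (h i w) t)%:E.
Proof.
have [h0 inth hneg] := walk_flow i w; rewrite /cumul EFin_Rint//.
by congr integral; apply/seteqP; split=> s; rewrite /arr take0 /= in_itv.
Qed.

Lemma inflow_netsum e t : (cumul (g e) t)%:E =
  netsum (fun i w => \sum_(j < size w | nth e1 w j == e) passed i w j t)%E.
Proof.
have [g0 intg gneg] := fg e; case: fhg => _ [_ [_ ind]].
rewrite -cumul_Icc// EFin_Rint// ind; apply: eq_netsum => i w wi.
apply: eq_bigr => j _; have [h0 inth hneg] := walk_flow i w.
apply: eq_mass => // s hs; split=> [/andP[]//|/= ->]; rewrite andbT.
apply: le_trans (arr_ge eps01 fg _ _ _); rewrite addr_ge0//.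
  by rewrite leNgt; apply/negP => /hneg/eqP; rewrite (negbTE hs).
by apply: sumr_ge0 => f _; exact: ltW (tau_gt0 eps01 f).
Qed.

(** Leaving the [j]-th edge is arriving at position [j.+1], so the outflow is the sum for the inflow
    with every index shifted by one. *)
Lemma outflow_netsum e t : (outflow eps g e t)%:E =
  netsum (fun i w => \sum_(j < size w | nth e1 w j == e) passed i w j.+1 t)%E.
Proof.
have [x Tx xP] := Texit_inv eps01 fg e t.
rewrite (outflowE xP) inflow_netsum; apply: eq_netsum => i w wi.
apply: eq_bigr => j /eqP wj; congr integral.
by apply/seteqP; split=> s /=; rewrite arrS// wj xP.
Qed.

Lemma big_all_edges (F : nat -> \bar R) w :
  (\sum_(e <- all_edges) \sum_(j < size w | nth e1 w j == e) F j =
   \sum_(j < size w) F j)%E.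
Proof.
rewrite (exchange_big_dep xpredT)//=; apply: eq_bigr => j _.
rewrite (_ : all_edges = [:: e1; e2; e3; e4; e5; e6; e7])// !big_cons big_nil.
by case: (nth e1 w j) => /=; rewrite ?adde0 ?add0e.
Qed.

(* Telescoping: the volume present on the edges is the volume that has
   departed minus the volume that has arrived. *)
Lemma conservation t :
  ((\sum_(e <- all_edges) cumul (g e) t)%:E + netsum (fun i w => passed i w (size w) t) =
   (\sum_(e <- all_edges) outflow eps g e t)%:E + netsum (fun i w => passed i w 0 t))%E.
Proof.
rewrite -!sumEFin.
under eq_bigr do rewrite inflow_netsum.
under [in RHS]eq_bigr do rewrite outflow_netsum.
rewrite -!netsum_sum -?netsumD//.
- apply: eq_netsum => i w _; rewrite (big_all_edges (fun j => passed i w j t)).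
  rewrite (big_all_edges (fun j => passed i w j.+1 t)).
  by rewrite -(big_ord_recr (size w) (fun j => passed i w j t))/= big_ord_recl addeC.
all: by move=> *; repeat (apply: sume_ge0 => ? _); exact: passed_ge0.
Qed.

End walk_flow.

(** * Piecewise constant rates *)

Definition box {R : realType} (c a b s : R) : R := if a <= s <= b then c else 0.

Section box.
Context {R : realType} (c a b : R).
Hypotheses (c0 : 0 <= c) (ab : a <= b).

Lemma box_ge0 s : 0 <= box c a b s.
Proof. by rewrite /box; case: ifP. Qed.

Lemma integral_box (A : set R) : measurable A ->
  (\int[leb]_(s in A) (box c a b s)%:E = c%:E * leb (A `&` `[a, b]))%E.
Proof.
move=> mA.
have mAab : measurable (A `&` `[a, b]) by exact: measurableI.
transitivity (\int[leb]_(s in A `&` `[a, b]) c%:E)%E; last exact: integral_cst.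
rewrite integral_mkcond [RHS]integral_mkcond; apply: eq_integral => s _.
rewrite !patchE in_setI /box; case: (s \in A) => //=.
suff -> : (s \in `[a, b]%classic) = (a <= s <= b) by case: ifP.
by apply/idP/idP; rewrite inE/= in_itv.
Qed.

Lemma integrable_box : leb.-integrable [set: R] (EFin \o box c a b).
Proof.
apply/integrableP; split.
  apply/measurable_EFinP; rewrite /box; apply: measurable_fun_ifT => //.
  apply: (@measurable_and _ _ _ (fun s => a <= s) (fun s => s <= b)).
    exact: measurable_fun_ler.
  exact: measurable_fun_ler.
under eq_integral => s _ do rewrite /= ger0_norm ?box_ge0//.
rewrite integral_box// setTI /leb lebesgue_measure_itv/= lte_fin.
by case: ifP => _; rewrite ?mule0 ?ltry// -EFinB -EFinM ltry.
Qed.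

Lemma cumul_box t : cumul (box c a b) t = c * Num.max 0 (Num.min t b - a).
Proof.
rewrite /cumul /Rint integral_box//.
have -> : `]-oo, t] `&` `[a, b] = `[a, Num.min t b]%classic.
  apply/seteqP; split=> s /=; rewrite !in_itv/= le_min.
    by move=> [-> /andP[-> ->]].
  by move=> /andP[-> /andP[-> ->]].
rewrite /leb lebesgue_measure_itv/= lte_fin; case: ifPn => [am|].
  by rewrite -EFinB -EFinM/= max_r// subr_ge0 ltW.
by rewrite -leNgt => ma; rewrite mule0/= max_l ?mulr0// subr_le0.
Qed.

End box.

(** * The walks of the network *)

Lemma is_walk_cons s d w : is_walk s d w -> exists e w', [/\ w = e :: w',
  esrc e = s & w' = [::] /\ edst e = d \/ is_walk (edst e) d w'].
Proof.
case: w => [//|e w] /and4P[_ /eqP /= es /eqP ed we].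
exists e, w; split => //; case: w we ed {es} => [|e' w]/= => [_ ->|]; first by left.
by move=> /andP[/eqP ee' we'] ed; right; rewrite /is_walk/= ee' ed we' !eqxx.
Qed.

Lemma walks1P w : walks k1 w ->
  w = [:: e7] \/ exists e w', w = [:: e7, e & w'].
Proof.
move=> /is_walk_cons[[]] [w1 [-> // _ [[-> _]|]]]; first by left.
by move=> /is_walk_cons[e [w2 [-> _ _]]]; right; exists e, w2.
Qed.

(** From [z] only e5, e4 lead on to [b]. There e2 ends the walk, since continuing from [c] leads to
    the dead end [x]; the alternative e6 returns to [z] and forces e5, e4 again. The prefix is
    unfolded just far enough to exhibit that second passage of e4. *)
Lemma walks2P w : walks k2 w ->
  w = [:: e5; e4; e2] \/ exists w', w = [:: e5, e4, e6, e5, e4 & w'].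
Proof.
move=> /is_walk_cons[[]] [w1 [-> // _ [[] //|]]].
move=> /is_walk_cons[[]] [w2 [-> // _ [[] //|]]].
move=> /is_walk_cons[[]] [w3 [-> // _ [[] //|]]].
- by move=> ->; left.
- by move=> /is_walk_cons[[]] [w4 [-> // _ [[] //|]]] /is_walk_cons[[]] [w5 [-> // _ [[] //|]]].
move=> /is_walk_cons[[]] [w4 [-> // _ [[] //|]]].
by move=> /is_walk_cons[[]] [w5 [-> // _ _]]; right; exists w5.
Qed.

Lemma walks3P w : walks k3 w -> exists w', w = e3 :: w'.
Proof. by move=> /is_walk_cons[[]] [w1 [-> // _ _]]; exists w1. Qed.

Lemma walks4P w : walks k4 w ->
  w = [:: e1; e2; e3] \/ exists w', w = [:: e1, e6, e5, e4 & w'].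
Proof.
move=> /is_walk_cons[[]] [w1 [-> // _ [[] //|]]].
move=> /is_walk_cons[[]] [w2 [-> // _ [[] //|]]].
- move=> /is_walk_cons[[]] [w3 [-> // _ [[] -> //|]]]; first by left.
  by move=> /is_walk_cons[[]] [w4 [-> // _ _]].
move=> /is_walk_cons[[]] [w3 [-> // _ [[] //|]]].
by move=> /is_walk_cons[[]] [w4 [-> // _ _]]; right; exists w4.
Qed.

Lemma walks5P w : walks k5 w -> exists w', w = e4 :: w'.
Proof. by move=> /is_walk_cons[[]] [w1 [-> // _ _]]; exists w1. Qed.

Lemma measurable_esum (R : realType) (T : countType) (A : set T)
    (f : T -> R -> \bar R) :
  (forall x, A x -> measurable_fun [set: R] (f x)) ->
  (forall x s, A x -> 0 <= f x s)%E ->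
  measurable_fun [set: R] (fun s => \esum_(x in A) f x s)%E.
Proof.
move=> mf f0.
rewrite (_ : (fun s => _) = fun s => (\sum_(0 <= n <oo) (if @pickle_inv T n is Some x
    then (if x \in A then f x s else 0) else 0))%E); last first.
  by apply/funext => s; rewrite esum_pickle// => x; exact: f0.
apply: ge0_emeasurable_sum.
  move=> n s _ _; case: (@pickle_inv T n) => // x; case: (boolP (x \in A)) => //.
  by rewrite inE; exact: f0.
move=> n _; case: (@pickle_inv T n) => [x|]; last exact: measurable_cst.
case: (boolP (x \in A)) => [|_]; last exact: measurable_cst.
by rewrite inE; exact: mf.
Qed.

(** * Departed volume *)

Section departures.
Context {R : realType} (eps M tf' tf : R)
  (h : commodity -> seq edge -> R -> R) (g : edge -> R -> R).
Hypotheses (eps01 : 0 < eps <= 1)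
  (fhg : feasible eps M tf' tf h g).
Local Notation passed := (passed eps h g).
Let fg := feasible_flow fhg.

Lemma rate_ge0 i s : 0 <= rate M i s.
Proof. by case: i => /=; case: ifP. Qed.

(** Each [rate M i] is convertible to a [box], so the results on boxes apply to it directly. *)
Lemma integrable_rate i : leb.-integrable [set: R] (EFin \o rate M i).
Proof. by case: i; apply: integrable_box. Qed.

Lemma departed i t :
  (\esum_(w in walks i) passed i w 0 t = (cumul (rate M i) t)%:E)%E.
Proof.
rewrite /cumul EFin_Rint; [|exact: rate_ge0|exact: integrable_rate].
transitivity (\esum_(w in walks i) (\int[leb]_(s in `]-oo, t]) (h i w s)%:E))%E.
  apply: eq_esum => w _; have [h0 inth _] := walk_flow fhg i w.
  by rewrite (passed0 fhg) /cumul EFin_Rint.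
have mh w : measurable_fun [set: R] (EFin \o h i w).
  by case: (walk_flow fhg i w) => _ /integrableP[].
have h0 w s : (0 <= (h i w s)%:E)%E by rewrite lee_fin; case: (walk_flow fhg i w).
rewrite -(integral_esum (f := fun w s => (h i w s)%:E))//; last first.
  by move=> w _; exact: (measurable_funTS (mh w)).
apply: ge0_ae_eq_integral => //.
- apply: measurable_funTS; apply: measurable_esum => //.
  by move=> w _; exact: mh.
- by apply: measurable_funTS; case/integrableP : (integrable_rate i).
- by move=> s _; apply: esum_ge0.
- by move=> s _; rewrite lee_fin rate_ge0.
case: fhg => -[_ [_ /(_ i)]] + _; apply: negligibleS => s /= + sE; by apply.
Qed.

Lemma walk_flow_le_rate i w : walks i w -> {ae leb, forall s, h i w s <= rate M i s}.
Proof.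
move=> wi; case: fhg => -[_ [_ /(_ i)]] + _; apply: aeS => s sE.
by rewrite -lee_fin -sE; exact: esum_ge1.
Qed.

Definition departure_start (i : commodity) : R :=
  match i with k1 => 0 | k2 => 2 | k3 => 7 | k4 => 4 | k5 => 9 end.

(** Almost everywhere [h i w] is bounded by the rate, which vanishes before [departure_start i]. The
    start itself is a null set, hence the weak inequality in the hypothesis. *)
Lemma passed_eq0 i w j t : walks i w ->
  (forall s, arr eps g w j s <= t -> s <= departure_start i) -> passed i w j t = 0%E.
Proof.
move=> wi early; have [h0 inth _] := walk_flow fhg i w.
apply/eqP; rewrite eq_le (passed_ge0 fhg) andbT -(integral_set0 leb (EFin \o h i w)).
apply: ge0_mass_ae_le => //; first exact: integrable_measurable_fun.
have := aeI (ae_neq (departure_start i)) (walk_flow_le_rate wi).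
apply: aeS => s [si hr] /early si' hs; have := h0 s; rewrite le_eqVlt eq_sym (negbTE hs)/=.
move=> /lt_le_trans/(_ hr); rewrite ltNge => /negP; apply.
have {}si : s < departure_start i by rewrite lt_neqAle si.
by case: i {w wi early hr h0 inth hs si'} si => /= si; rewrite ifF// leNgt si.
Qed.

Lemma passed_all i w j t : walks i w ->
  (forall s, rate M i s != 0 -> arr eps g w j s <= t) ->
  passed i w j t = (\int[leb]_s (h i w s)%:E)%E.
Proof.
move=> wi late; have [h0 inth _] := walk_flow fhg i w.
apply/eqP; rewrite eq_le le_mass//=; apply: ge0_mass_ae_le => //.
- exact: integrable_measurable_fun.
- rewrite -[X in measurable X]setTI.
  rewrite (_ : [set s | _] = arr eps g w j @^-1` `]-oo, t]%classic); last first.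
    by apply/seteqP; split=> s /=; rewrite in_itv.
  exact: (measurable_arr eps01 fg).
have := walk_flow_le_rate wi; apply: aeS => s hr _ hs; apply: late.
by apply: contraNneq hs => r0; rewrite eq_le h0 andbT -r0.
Qed.

End departures.

(** * Lower bound when commodity 1 makes no detour *)

Section no_detour.
Context {R : realType} (eps M tf' tf : R)
  (h : commodity -> seq edge -> R -> R) (g : edge -> R -> R).
Hypotheses (eps01 : 0 < eps <= 1)
  (fhg : feasible eps M tf' tf h g).
Local Notation passed := (passed eps h g).
Let fg := feasible_flow fhg.

Lemma arr_ge_take w j k s : (k <= j)%N ->
  s + \sum_(e <- take k w) tau eps e <= arr eps g w j s.
Proof.
by move=> kj; apply: le_trans (arr_ge eps01 fg w k s) _; exact: arr_le.
Qed.

(* Tolls are nonnegative, so prolonging a walk that already reaches the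
   destination only makes it costlier. *)
Lemma DUE_direct p w j t : (forall e t, 0 <= p e t) -> DUE_cond eps p h g ->
  walks k1 w -> w != [:: e7] -> passed k1 w j t = 0%E.
Proof.
move=> p0 due wi w7; have [h0 inth _] := walk_flow fhg k1 w.
apply/eqP; rewrite eq_le (passed_ge0 fhg) andbT -(integral_set0 leb (EFin \o h k1 w)).
apply: ge0_mass_ae_le => //; first exact: integrable_measurable_fun.
have /due := mem_set wi; apply: aeS => s hs _ hs0.
have {}hs0 : 0 < h k1 w s by rewrite lt_neqAle eq_sym hs0 h0.
have := hs hs0 [:: e7]; rewrite inE => /(_ isT).
have [w7E|[e [w' wE]]] := walks1P wi; first by rewrite w7E eqxx in w7.
rewrite leNgt => /negP; apply; apply: ltr_leD.
  rewrite /Psi !mul1r ltrD2r.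
  apply: (@lt_le_trans _ _ (arr eps g w 2 s)); last by rewrite arr_le// wE.
  rewrite wE /arr/= take0/=; apply: lt_le_trans (Texit_ge eps01 fg _ _).
  by rewrite ltrDl tau_gt0.
rewrite /Ptoll wE big_ord_recl/= big_ord0 addr0 big_ord_recl/=.
by rewrite lerDl sumr_ge0.
Qed.

End no_detour.

Lemma ramp_lip (R : realType) (a b s t : R) : s <= t ->
  Num.max 0 (Num.min t b - a) - Num.max 0 (Num.min s b - a) <= t - s.
Proof.
by move=> st; rewrite /Num.max /Num.min; do !case: ifPn => //; rewrite -?leNgt => *; lra.
Qed.

Lemma sum_single (R : realType) (n : nat) (P : pred nat) (F : nat -> \bar R) (k : nat) :
  (k < n)%N -> P k -> (forall j, P j -> j != k -> F j = 0%E) ->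
  (\sum_(j < n | P j) F j = F k)%E.
Proof.
move=> kn Pk F0; rewrite (bigD1 (Ordinal kn))//= big1 ?adde0// => j /andP[Pj jk].
by apply: F0 => //; apply: contraNneq jk => jk; apply/eqP/val_inj.
Qed.

(** * The timetable of commodity 2 until time 5 *)

Section early.
Context {R : realType} (eps M tf' tf : R)
  (h : commodity -> seq edge -> R -> R) (g : edge -> R -> R).
Hypotheses (eps0 : 0 < eps) (eps1 : eps <= 1)
  (fhg : feasible eps M tf' tf h g).
Let eps01 : 0 < eps <= 1. Proof. by rewrite eps0. Qed.
Local Notation passed := (passed eps h g).
Hypothesis direct : forall w j t, walks k1 w -> w != [:: e7] -> passed k1 w j t = 0%E.
Let fg := feasible_flow fhg.
Ltac elra := move: (eps0) (eps1) => ? ?; lra.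

Lemma passed_sub i w j k a b : (forall s, arr eps g w j s <= a -> arr eps g w k s <= b) ->
  (passed i w j a <= passed i w k b)%E.
Proof. by move=> ab; apply: le_mass => //; case: (walk_flow fhg i w). Qed.

Lemma passed_early i w j k t : walks i w -> (k <= j)%N ->
  t <= departure_start i + \sum_(e <- take k w) tau eps e -> passed i w j t = 0%E.
Proof.
move=> wi kj te; apply: (passed_eq0 fhg wi) => s st.
by have := arr_ge_take eps01 fhg w s kj => ?; elra.
Qed.

Lemma sum_passed_k1 w e (f : nat -> nat) t : walks k1 w -> e != e7 ->
  (\sum_(j < size w | nth e1 w j == e) passed k1 w (f j) t = 0)%E.
Proof.
move=> wi e7e; have [->|w7] := eqVneq w [:: e7]; last first.
  by rewrite big1// => j _; exact: direct.
by rewrite big1// => -[[|//] ?] /=; rewrite eq_sym (negbTE e7e).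
Qed.

Lemma sum_passed_late i w e (f : nat -> nat) t : walks i w -> t <= departure_start i ->
  (\sum_(j < size w | nth e1 w j == e) passed i w (f j) t = 0)%E.
Proof.
move=> wi ti; rewrite big1// => j _; apply: (passed_early (k := 0)) => //.
by rewrite take0 big_nil addr0.
Qed.

Lemma netsumE (F : commodity -> seq edge -> \bar R) : netsum F =
  (\esum_(w in walks k1) F k1 w + (\esum_(w in walks k2) F k2 w +
  (\esum_(w in walks k3) F k3 w + (\esum_(w in walks k4) F k4 w +
   \esum_(w in walks k5) F k5 w))))%E.
Proof. by rewrite /netsum !big_cons big_nil adde0. Qed.

Lemma cumul_rate2 t : cumul (rate M k2) t = 2 * Num.max 0 (Num.min t 3 - 2).
Proof. by apply: (@cumul_box R 2 2 3); elra. Qed.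

(** Until time 3 no other commodity is on e5: commodity 1 stops at [z], commodities 3 to 5 have not
    started, and a second visit by commodity 2 occurs after time 4 at the earliest. *)
Lemma inflow5 t : t <= 3 -> cumul (g e5) t = cumul (rate M k2) t.
Proof.
move=> t3; apply: EFin_inj; rewrite (inflow_netsum eps01 fhg) -(departed fhg) netsumE.
rewrite esum1 ?add0e; last by move=> w wi; rewrite (sum_passed_k1 id).
rewrite [X in (_ + X)%E](_ : _ = 0%E) ?adde0; last first.
  by rewrite !esum1 ?adde0// => w wi; apply: (sum_passed_late _ id) => //=; elra.
apply: eq_esum => w wi.
rewrite (@sum_single _ _ (fun j => nth e1 w j == e5) (fun j => passed k2 w j t) 0%N)//.
- by have [->|[w' ->]] := walks2P wi.
- by have [->|[w' ->]] := walks2P wi.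
move=> [//|[|j]] wj _; first by have [wE|[w' wE]] := walks2P wi; rewrite wE in wj.
apply: (passed_early (k := 2)) => //.
by have [->|[w' ->]] := walks2P wi; rewrite !big_cons big_nil/=; elra.
Qed.

Lemma exit5 t : t <= 3 -> Texit eps g e5 t = t + (2 - eps).
Proof.
move=> t3; apply: (Texit_noqueue eps01 fg (n := 2)) => // s st.
rewrite !inflow5//; last exact: le_trans t3.
by rewrite !cumul_rate2 -mulrBr ler_wpM2l// ramp_lip.
Qed.

(** By [5 - eps] commodity 4 is still on e1, commodities 3 and 5 have not started, and commodity 2
    cannot have looped. Commodity 2 spends at least [2 - eps] on e5, so what has entered e4 departed
    by time 3. *)
Lemma inflow4_le : cumul (g e4) (5 - eps) <= cumul (rate M k2) 3.
Proof.
rewrite -lee_fin (inflow_netsum eps01 fhg) -(departed fhg) netsumE.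
rewrite esum1 ?add0e; last by move=> w wi; rewrite (sum_passed_k1 id).
rewrite [X in (_ + X <= _)%E](_ : _ = 0%E) ?adde0; last first.
  rewrite !esum1 ?adde0// => w wi.
  - by apply: (sum_passed_late _ id) => //=; elra.
  - rewrite big1// => -[j jw] /= /eqP wj; apply: (passed_early (k := 1)) => //.
      by have [wE|[w' wE]] := walks4P wi; move: wj; rewrite wE; case: j {jw}.
    by have [->|[w' ->]] := walks4P wi; rewrite !big_cons big_nil/=; elra.
  - by apply: (sum_passed_late _ id) => //=; elra.
apply: le_esum => w wi.
rewrite (@sum_single _ _ (fun j => nth e1 w j == e4) (fun j => passed k2 w j (5 - eps)) 1%N)//.
- apply: passed_sub => s; rewrite {2}/arr take0/= => /(le_trans (arr_ge_take eps01 fhg w s (leqnn 1))).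
  by have [->|[w' ->]] := walks2P wi; rewrite !big_cons big_nil/=; elra.
- by have [->|[w' ->]] := walks2P wi.
- by have [->|[w' ->]] := walks2P wi.
move=> [|[//|[|j]]] wj _; try by have [wE|[w' wE]] := walks2P wi; rewrite wE in wj.
have [wE|[w' wE]] := walks2P wi; first by rewrite wE in wj; case: j wj => //.
by apply: (passed_early (k := 3)) => //; rewrite wE !big_cons big_nil/=; elra.
Qed.

Lemma inflow4_ge s : s <= 5 - eps ->
  cumul (rate M k2) (s - (2 - eps)) <= cumul (g e4) s.
Proof.
move=> s5; rewrite -lee_fin (inflow_netsum eps01 fhg) -(departed fhg) netsumE.
rewrite -[leLHS]add0e; apply: leeD.
  by apply: esum_ge0 => w _; apply: sume_ge0 => j _; exact: passed_ge0 fhg _ _ _ _.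
rewrite -[leLHS]adde0; apply: leeD; last first.
  by rewrite !adde_ge0//; apply: esum_ge0 => w _; apply: sume_ge0 => j _; exact: passed_ge0 fhg _ _ _ _.
apply: le_esum => w wi.
have w1 : (1 < size w)%N by have [->|[w' ->]] := walks2P wi.
rewrite (bigD1 (Ordinal w1))/=; last by have [->|[w' ->]] := walks2P wi.
rewrite -[leLHS]adde0; apply: leeD; last first.
  by apply: sume_ge0 => j _; exact: passed_ge0 fhg _ _ _ _.
apply: passed_sub => r; rewrite {1}/arr take0/= => rs.
have -> : arr eps g w 1 r = Texit eps g e5 r.
  by have [->|[w' ->]] := walks2P wi; rewrite /arr/= ?take0.
by rewrite exit5; elra.
Qed.

(** The last of commodity 2 reaches e4 at [5 - eps]. The upper bound on the inflow at that time and
    the lower bound at every earlier time leave an increment of at most [2 * (5 - eps - s)], so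
    there is no queue. *)
Lemma exit4 : Texit eps g e4 (5 - eps) = 5.
Proof.
rewrite (Texit_noqueue eps01 fg (n := 2))//=; first by rewrite subrK.
move=> s s5; have := inflow4_le; have := inflow4_ge s5; rewrite !cumul_rate2.
have s3 : s - (2 - eps) <= 3 by elra.
by have := ramp_lip 2 3 s3 => ? ? ?; elra.
Qed.

End early.

(** * Volume that can have arrived by a given time *)

Section arrivals.
Context {R : realType} (eps M tf' tf : R)
  (h : commodity -> seq edge -> R -> R) (g : edge -> R -> R).
Hypotheses (eps0 : 0 < eps) (eps1 : eps <= 1) (M0 : 0 <= M)
  (fhg : feasible eps M tf' tf h g).
Let eps01 : 0 < eps <= 1. Proof. by rewrite eps0. Qed.
Local Notation passed := (passed eps h g).
Hypothesis direct : forall w j t, walks k1 w -> w != [:: e7] -> passed k1 w j t = 0%E.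
Let fg := feasible_flow fhg.
Ltac elra := move: (eps0) (eps1) (M0) => ? ? ?; lra.

Let dir2 := [:: e5; e4; e2].
Let dir4 := [:: e1; e2; e3].
Let V2 : \bar R := (\int[leb]_s (h k2 dir2 s)%:E)%E.

Lemma sum_passed_ge0 i w e (f : nat -> nat) t :
  (0 <= \sum_(j < size w | nth e1 w j == e) passed i w (f j) t)%E.
Proof. by apply: sume_ge0 => j _; exact: passed_ge0 fhg _ _ _ _. Qed.

Lemma esum_sum_ge0 i e (f : nat -> nat) t :
  (0 <= \esum_(w in walks i) \sum_(j < size w | nth e1 w j == e) passed i w (f j) t)%E.
Proof. by apply: esum_ge0 => w _; exact: sum_passed_ge0. Qed.

(** Commodity 2 cannot reach the end of e2 before [2 + (2 - eps) + eps + 1 = 5], and commodity 4 not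
    before [4 + 1 + 1 = 6]. *)
Lemma outflow2_5 : outflow eps g e2 5 <= 0.
Proof.
rewrite -lee_fin (outflow_netsum eps01 fhg) netsumE.
have start0 i w : walks i w -> 5 <= departure_start i :> R ->
    (\sum_(j < size w | nth e1 w j == e2) passed i w j.+1 5 = 0)%E.
  by move=> wi i5; exact: (sum_passed_late eps0 eps1 fhg _ S).
rewrite (@esum1 _ _ (walks k1)); last first.
  by move=> w wi; exact: (sum_passed_k1 direct S).
rewrite (@esum1 _ _ (walks k3)); last by move=> w wi; apply: start0 => //=; lra.
rewrite (@esum1 _ _ (walks k5)); last by move=> w wi; apply: start0 => //=; lra.
rewrite (@esum1 _ _ (walks k2)); last first.
  move=> w wi; rewrite big1// => -[j jw] /= /eqP wj.
  apply: (passed_early eps0 eps1 fhg (k := 3)) => //.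
    by have [wE|[w' wE]] := walks2P wi; move: wj; rewrite wE; case: j {jw} => [|[|]].
  by have [->|[w' ->]] := walks2P wi; rewrite !big_cons big_nil/=; elra.
rewrite (@esum1 _ _ (walks k4)) ?adde0//.
move=> w wi; rewrite big1// => -[j jw] /= /eqP wj.
apply: (passed_early eps0 eps1 fhg (k := 2)) => //.
  by have [wE|[w' wE]] := walks4P wi; move: wj; rewrite wE; case: j {jw}.
by have [->|[w' ->]] := walks4P wi; rewrite !big_cons big_nil/=; elra.
Qed.

Lemma sum_passed_ge1 i w e k t : walks i w -> (k < size w)%N -> nth e1 w k = e ->
  (passed i w k.+1 t <=
   \esum_(w in walks i) \sum_(j < size w | nth e1 w j == e) passed i w j.+1 t)%E.
Proof.
move=> wi kw ke.
apply: le_trans (esum_ge1 (fun w => \sum_(j < size w | nth e1 w j == e) passed i w j.+1 t)%E wi).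
rewrite (bigD1 (Ordinal kw))/= ?ke// leeDl//.
by apply: sume_ge0 => j _; exact: passed_ge0 fhg _ _ _ _.
Qed.

(** The two direct walks compete for e2. All of commodity 2 on its direct walk has entered e2 by
    time 5. If an entry at 5 leaves by 7, both volumes leave e2 during [[5, 7]], where the capacity
    admits 2. Otherwise commodity 4, which enters no earlier than 5, leaves e2 after 7 and e3 after
    [7 + eps], so only the volume of commodity 2 remains, at most 2. *)
Lemma early_volume : (V2 + passed k4 dir4 3 (7 + eps) <= 2%:E)%E.
Proof.
have w2 : walks k2 dir2 by [].
have w4 : walks k4 dir4 by [].
have [T7|T7] := leP (Texit eps g e2 5) 7.
  have : outflow eps g e2 7 <= 2.
    have := @outflow_le _ _ _ eps01 fg e2 1 5 7 erefl.
    by have := outflow2_5; lra.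
  rewrite -lee_fin (outflow_netsum eps01 fhg) netsumE; apply: le_trans.
  apply: le_trans (leeDr _ (esum_sum_ge0 k1 e2 S 7)).
  apply: leeD.
    apply: le_trans (sum_passed_ge1 7 w2 (isT : 2 < size dir2)%N erefl).
    rewrite le_eqVlt; apply/orP; left; apply/eqP/esym/(passed_all eps01 fhg w2) => s /=.
    case: ifP => [/andP[_ s3] _|]; last by rewrite eqxx.
    apply: le_trans T7; rewrite /arr/=; apply: Texit_nd => //.
    rewrite -(exit4 eps0 eps1 fhg direct); apply: Texit_nd => //.
    rewrite -(_ : Texit eps g e5 3 = 5 - eps); first exact: Texit_nd.
    by rewrite (exit5 eps0 eps1 fhg direct)//; ring.
  apply: le_trans (leeDr _ (esum_sum_ge0 k3 e2 S 7)).
  apply: le_trans (leeDl _ (esum_sum_ge0 k5 e2 S 7)).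
  apply: le_trans (sum_passed_ge1 7 w4 (isT : 1 < size dir4)%N erefl).
  apply: (passed_sub fhg) => s; rewrite /arr/=.
  by have := Texit_ge eps01 fg e3 (Texit eps g e2 (Texit eps g e1 s)) => /= ? ?; lra.
rewrite (_ : passed k4 _ _ _ = 0%E) ?adde0.
  rewrite /V2 -(@passed_all _ _ _ _ _ _ _ eps01 fhg _ _ 0 3 w2); last first.
    move=> s /=; case: ifP => [/andP[_ s3] _|]; last by rewrite eqxx.
    by rewrite /arr take0.
  apply: (@le_trans _ _ (\esum_(w in walks k2) passed k2 w 0 3)%E).
    exact: (esum_ge1 (fun w => passed k2 w 0 3) w2).
  rewrite (departed fhg) lee_fin cumul_rate2 /Num.max /Num.min.
  by do !case: ifPn => //; rewrite -?leNgt => *; lra.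
apply: (passed_eq0 fhg w4) => s; rewrite /arr/= => s7; rewrite leNgt; apply/negP => s4.
have T1 : 5 <= Texit eps g e1 s by have := Texit_ge eps01 fg e1 s => /= ?; lra.
have T12 := Texit_nd eps01 fg e2 T1.
have := Texit_ge eps01 fg e3 (Texit eps g e2 (Texit eps g e1 s)) => /= ?; lra.
Qed.

Lemma sum_passed_le i w e a b : a <= b ->
  (\sum_(j < size w | nth e1 w j == e) passed i w j.+1 a <=
   \sum_(j < size w | nth e1 w j == e) passed i w j.+1 b)%E.
Proof. by move=> ab; apply: lee_sum => j _; exact: (le_passed eps01 fhg). Qed.

(** The passage at position [k] has not occurred by [a], while whoever has arrived by [b] has made
    it; this one term pays for the arrivals, and all others grow with time. *)
Lemma sum_passed_last i w e a b k : a <= b -> (k < size w)%N -> nth e1 w k = e ->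
  passed i w k.+1 a = 0%E ->
  (passed i w (size w) b + \sum_(j < size w | nth e1 w j == e) passed i w j.+1 a <=
   \sum_(j < size w | nth e1 w j == e) passed i w j.+1 b)%E.
Proof.
move=> ab kw ke k0; rewrite (bigD1 (Ordinal kw))/= ?ke// [leRHS](bigD1 (Ordinal kw))/= ?ke//.
rewrite k0 add0e; apply: leeD; first exact: (le_passed eps01 fhg).
by apply: lee_sum => j _; exact: (le_passed eps01 fhg).
Qed.

(* Beyond its last passage of e3 or e4, whose outflow is bounded by the capacity,
   only commodity 1 and the direct walks of commodities 2 and 4 can deliver
   volume; [early_volume] bounds the latter two. *)
Lemma arrived_le t : 11 <= t ->
  (netsum (fun i w => passed i w (size w) t) +
     ((outflow eps g e4 (9 + eps))%:E + (outflow eps g e3 (7 + eps))%:E) <=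
   (\esum_(w in walks k1) passed k1 w 0 t + (V2 + passed k4 dir4 3 (7 + eps))) +
     ((outflow eps g e4 t)%:E + (outflow eps g e3 t)%:E))%E.
Proof.
move=> t11.
pose Nd := passed k4 dir4 3 (7 + eps).
have V20 : (0 <= V2)%E by apply: mass_ge0; case: (walk_flow fhg k2 dir2).
have Nd0 : (0 <= Nd)%E by exact: passed_ge0 fhg _ _ _ _.
(* [X] collects the arrivals that are not charged to a passage of e3 or e4. *)
pose X i w : \bar R := match i with
  | k1 => passed k1 w 0 t
  | k2 => if w == dir2 then V2 else 0%E
  | k4 => if w == dir4 then Nd else 0%E
  | _ => 0%E end.
have X0 i w : (0 <= X i w)%E.
  by case: i => //=; [exact: passed_ge0 fhg _ _ _ _|case: ifP|case: ifP].
have -> : (\esum_(w in walks k1) passed k1 w 0 t + (V2 + Nd) = netsum X)%E.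
  by rewrite netsumE/= !esum_pick// !(esum1 (a := cst 0%E))// !adde0 !add0e.
have le4 : 9 + eps <= t by elra.
have le3 : 7 + eps <= t by elra.
rewrite !(outflow_netsum eps01 fhg) -!netsumD//.
all: try by move=> i w; exact: (passed_ge0 fhg).
all: try by move=> i w; rewrite ?adde_ge0 ?sum_passed_ge0.
apply: le_netsum => i w wi.
(* A walk is charged to an occurrence of e4 that cannot be completed before [9 + eps]. For a looping
   commodity 2 this is the second occurrence, completed at 10 at the earliest; for a looping
   commodity 4 the earliest completion is at 11. *)
have use4 k : (k < size w)%N -> nth e1 w k = e4 -> passed i w k.+1 (9 + eps) = 0%E ->
    (passed i w (size w) t + (\sum_(j < size w | nth e1 w j == e4) passed i w j.+1 (9 + eps) +
       \sum_(j < size w | nth e1 w j == e3) passed i w j.+1 (7 + eps)) <=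
     X i w + (\sum_(j < size w | nth e1 w j == e4) passed i w j.+1 t +
       \sum_(j < size w | nth e1 w j == e3) passed i w j.+1 t))%E.
  move=> kw k4 kz; rewrite addeA -[leLHS]add0e leeD// leeD ?sum_passed_le//.
  exact: (sum_passed_last le4 kw k4 kz).
have useX : (passed i w (size w) t <= X i w)%E ->
    (passed i w (size w) t + (\sum_(j < size w | nth e1 w j == e4) passed i w j.+1 (9 + eps) +
       \sum_(j < size w | nth e1 w j == e3) passed i w j.+1 (7 + eps)) <=
     X i w + (\sum_(j < size w | nth e1 w j == e4) passed i w j.+1 t +
       \sum_(j < size w | nth e1 w j == e3) passed i w j.+1 t))%E.
  by move=> lX; rewrite leeD// leeD// sum_passed_le.
case: i wi X0 use4 useX => wi X0 use4 useX.
- by apply: useX; exact: (le_passed eps01 fhg).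
- have [w2|[w' wE]] := walks2P wi.
    apply: useX; rewrite /X w2 eqxx; apply: le_mass => //.
    by case: (walk_flow fhg k2 dir2).
  apply: (use4 4%N); rewrite ?wE//; rewrite -wE.
  apply: (passed_early eps0 eps1 fhg (k := 5)) => //.
  by rewrite wE /= take0 !big_cons big_nil/=; elra.
- have [w' wE] := walks3P wi.
  rewrite addeCA [leRHS]addeCA leeD ?sum_passed_le// -[leLHS]add0e leeD//.
  apply: (sum_passed_last (k := 0) le3); rewrite ?wE//; rewrite -wE.
  apply: (passed_early eps0 eps1 fhg (k := 1)) => //.
  by rewrite wE /= take0 !big_cons big_nil/=; elra.
- have [wE|[w' wE]] := walks4P wi; last first.
    apply: (use4 3%N); rewrite ?wE//; rewrite -wE.
    apply: (passed_early eps0 eps1 fhg (k := 4)) => //.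
    by rewrite wE /= take0 !big_cons big_nil/=; elra.
  (* On its direct walk commodity 4 arrives exactly when it leaves e3, so its volume by [t] cancels
     and only the part that left e3 by [7 + eps] remains. *)
  have S3 a : (\sum_(j < size dir4 | nth e1 dir4 j == e3) passed k4 dir4 j.+1 a =
      passed k4 dir4 3 a)%E.
    apply: (@sum_single _ _ (fun j => nth e1 dir4 j == e3)
      (fun j => passed k4 dir4 j.+1 a) 2%N) => //.
    by move=> [|[|[|[|j]]]].
  rewrite addeCA [leRHS]addeCA leeD ?sum_passed_le// wE !S3 /X eqxx.
  by rewrite addeC.
have [w' wE] := walks5P wi; apply: (use4 0%N); rewrite ?wE//; rewrite -wE.
apply: (passed_early eps0 eps1 fhg (k := 1)) => //.
by rewrite wE /= take0 !big_cons big_nil/=; elra.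
Qed.

(** By [t] a volume [3 * t - 16] has departed. The arrived volume is at most [6 + 2 + 2 * (t - 9 -
    eps) + (t - 7 - eps)]: commodity 1, [early_volume], and what e4 and e3 can release after the
    earliest times at which commodities 5 and 3 leave them. The difference is [1 + 3 * eps]. *)
Lemma volume_present t : 11 <= t -> t <= 10 + M ->
  1 + 3 * eps <= \sum_(e <- all_edges) (cumul (g e) t - outflow eps g e t).
Proof.
move=> t11 tM; have := conservation eps01 fhg t; have := arrived_le t11.
have := early_volume; set Nd := passed _ _ _ _.
have c1 : cumul (rate M k1) t = 6.
  rewrite (_ : cumul _ t = 6 * Num.max 0 (Num.min t 1 - 0)); last by apply: (@cumul_box R 6 0 1); lra.
  by rewrite min_r ?max_r; lra.
have c2 : cumul (rate M k2) t = 2.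
  by rewrite cumul_rate2 min_r ?max_r; lra.
have c3 : cumul (rate M k3) t = t - 7.
  rewrite (_ : cumul _ t = 1 * Num.max 0 (Num.min t (10 + M) - 7)); last by apply: (@cumul_box R 1 7 (10 + M)); elra.
  by rewrite min_l ?max_r; lra.
have c4 : cumul (rate M k4) t = 1.
  rewrite (_ : cumul _ t = 1 * Num.max 0 (Num.min t 5 - 4)); last by apply: (@cumul_box R 1 4 5); lra.
  by rewrite min_r ?max_r; lra.
have c5 : cumul (rate M k5) t = 2 * (t - 9).
  rewrite (_ : cumul _ t = 2 * Num.max 0 (Num.min t (13 + M) - 9)); last by apply: (@cumul_box R 2 9 (13 + M)); elra.
  by rewrite min_l ?max_r; lra.
rewrite (netsumE (fun i w => passed i w 0 t)) !(departed fhg) c1 c2 c3 c4 c5.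
have V20 : (0 <= V2)%E by apply: mass_ge0; case: (walk_flow fhg k2 dir2).
have Nd0 : (0 <= Nd)%E by exact: passed_ge0 fhg _ _ _ _.
have L0 : (0 <= netsum (fun i w => passed i w (size w) t))%E.
  by apply: netsum_ge0 => i w; exact: passed_ge0 fhg _ _ _ _.
have := @outflow_le _ _ _ eps01 fg e4 2 (9 + eps) t erefl.
have := @outflow_le _ _ _ eps01 fg e3 1 (7 + eps) t erefl.
have le3 : 7 + eps <= t by elra.
have le4 : 9 + eps <= t by elra.
move=> /(_ le3) o3 /(_ le4) o4.
rewrite sumrB; move: (netsum _) L0 => L; move: V2 V20 Nd Nd0 => V V0 N N0.
case: V V0 => [v| |]// V0; case: N N0 => [n| |]// N0; case: L => [l| |]// L0.
rewrite -!EFinD !lee_fin => nv la lcE; have lc := EFin_inj lcE.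
by move: V0 N0 L0; rewrite !lee_fin => ? ? ?; elra.
Qed.

End arrivals.

(** * Travel time as integrated volume *)

Section edge_time.
Context {R : realType} (eps : R) (g : edge -> R -> R) (e : edge) (a b tf : R).
Hypotheses (eps01 : 0 < eps <= 1) (fg : flow g) (ab : a <= b)
  (gtf : forall s, ~ (0 <= s <= tf) -> g e s = 0).

Let T := Texit eps g e.

(** The first component is an entry time, the second a moment at which that entry is observed on the
    edge. *)
Let held (z : measurableTypeR R * measurableTypeR R) : bool :=
  [&& z.1 <= z.2, z.2 < T z.1, a <= z.2 & z.2 <= b].

Let f (z : measurableTypeR R * measurableTypeR R) : \bar R :=
  ((if held z then g e z.1 else 0)%R)%:E.

Let g0 s : 0 <= g e s. Proof. by case: (fg e). Qed.
Let intg : leb.-integrable [set: R] (EFin \o g e). Proof. by case: (fg e). Qed.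
Let mg : measurable_fun [set: R] (g e). Proof. exact: integrable_measurable_fun. Qed.

Let mf : measurable_fun [set: measurableTypeR R * measurableTypeR R] f.
Proof.
have m1 : measurable_fun [set: measurableTypeR R * measurableTypeR R]
    (fst : _ -> measurableTypeR R) by exact: measurable_fst.
have m2 : measurable_fun [set: measurableTypeR R * measurableTypeR R]
    (snd : _ -> measurableTypeR R) by exact: measurable_snd.
have mT1 : measurable_fun [set: measurableTypeR R * measurableTypeR R] (T \o fst).
  by apply: measurableT_comp => //; exact: measurable_Texit.
apply/measurable_EFinP; apply: measurable_fun_ifT => //; last first.
  exact: (@measurableT_comp _ _ _ _ _ _ (g e)).
apply: measurable_and; first exact: measurable_fun_ler.
apply: measurable_and; first exact: measurable_fun_ltr.
by apply: measurable_and; exact: measurable_fun_ler.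
Qed.

Let f0 z : (0 <= f z)%E.
Proof. by rewrite lee_fin; case: ifP. Qed.

(* Exchanging the order of integration, the time spent on an edge is the
   integral over time of the volume present on it. *)
Lemma edge_time_ge :
  (\int[leb]_(t in `[a, b]) (cumul (g e) t - outflow eps g e t)%:E <=
   \int[leb]_(s in [set s | (0 <= s <= tf)%R]) (Dtime eps g e s * g e s)%:E)%E.
Proof.
have Dge s : 0 <= Dtime eps g e s.
  have := Texit_ge eps01 fg e s; rewrite /Texit lerD2l; apply: le_trans.
  exact: ltW (tau_gt0 eps01 e).
have -> : (\int[leb]_(s in [set s | (0 <= s <= tf)%R]) (Dtime eps g e s * g e s)%:E =
    \int[leb]_s (Dtime eps g e s * g e s)%:E)%E.
  apply: eq_mass => s Dg; split=> // _ /=; apply/negPn/negP => /negP/gtf gs.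
  by rewrite gs mulr0 eqxx in Dg.
(* For fixed [t] the entries still present are those in []x, t]], where [x] is the last entry that
   has left by [t]. *)
have inner_s t : (\int[leb]_s f (s, t) =
    if (a <= t <= b)%R then (cumul (g e) t - outflow eps g e t)%:E else 0)%E.
  case: ifPn => [tab|ntab]; last first.
    rewrite integral0_eq// => s _; rewrite /f /held/= (_ : _ && _ = false)//.
    by rewrite (negbTE ntab) !andbF.
  have [x Tx xP] := Texit_inv eps01 fg e t.
  have xt : x <= t.
    rewrite -Tx; apply: le_trans (Texit_ge eps01 fg e x).
    by rewrite lerDl ltW// tau_gt0.
  rewrite (outflowE xP) /cumul [in RHS](@Rintegral_itvB R (g e) -oo%O (BRight t))//; last first.
    by apply: integrableS intg.
  rewrite -[RHS]/((Rint `]x, t]%classic (g e))%:E) EFin_Rint//.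
  rewrite [RHS]integral_mkcond; apply: eq_integral => s _.
  rewrite /f /held/= tab andbT patchE /T ltNge xP -ltNge andbC.
  suff -> : (s \in `]x, t]%classic) = (x < s <= t) by case: ifP.
  by apply/idP/idP; rewrite inE/= in_itv.
have -> : (\int[leb]_(t in `[a, b]) (cumul (g e) t - outflow eps g e t)%:E =
    \int[leb]_t \int[leb]_s f (s, t))%E.
  rewrite integral_mkcond; apply: eq_integral => t _; rewrite inner_s patchE.
  suff -> : (t \in `[a, b]%classic) = (a <= t <= b) by [].
  by apply/idP/idP; rewrite inE/= in_itv.
rewrite -(@fubini_tonelli _ _ _ _ _ lebesgue_measure lebesgue_measure f)//.
apply: ge0_le_integral => //.
- by move=> s _; exact: integral_ge0.
- exact: (@measurable_fun_fubini_tonelli_F _ _ _ _ _ lebesgue_measure f mf f0).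
- apply/measurable_EFinP; apply: measurable_funM => //.
  rewrite (_ : Dtime _ _ _ = (fun s => T s - s)).
    by apply: measurable_funB => //; exact: measurable_Texit.
  by apply/funext => s; rewrite /T /Texit addrC addKr.
move=> s _.
have sT : s <= T s.
  apply: le_trans (Texit_ge eps01 fg e s); rewrite lerDl ltW// tau_gt0//.
(* For a fixed entry time, forgetting the window [[a, b]] leaves a box on [[s, T s]], whose mass is
   the traversal time multiplied by the inflow rate. *)
apply: (@le_trans _ _ (\int[leb]_t (box (g e s) s (T s) t)%:E)%E).
  apply: ge0_le_integral => //.
  - exact: (measurableT_comp mf (measurable_pair1 s)).
  - by case/integrableP : (@integrable_box R (g e s) s (T s) (g0 s)).
  move=> t _; rewrite lee_fin /held/box/=; case: ifPn => [/and4P[-> /ltW -> _ _]//|_].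
  by case: ifP.
rewrite integral_box// setTI /leb lebesgue_measure_itv/= lte_fin; case: ifPn => _.
  by rewrite -EFinB -EFinM lee_fin /T /Texit addrC addKr mulrC.
by rewrite mule0 lee_fin mulr_ge0.
Qed.

End edge_time.

Lemma leb_cc (R : realType) (a b : R) : a <= b -> leb `[a, b] = (b - a)%:E.
Proof.
move=> ab; rewrite /leb lebesgue_measure_itv/= lte_fin -EFinB; case: ltP => // ba.
have -> : a = b by apply/eqP; rewrite eq_le ab ba.
by rewrite subrr.
Qed.

Lemma outflow_le_cumul (R : realType) (eps : R) (g : edge -> R -> R) e t :
  0 < eps <= 1 -> flow g -> outflow eps g e t <= cumul (g e) t.
Proof.
move=> eps01 fg; have [g0 intg _] := fg e.
apply: le_Rint => // s /= Tt; rewrite in_itv/=; apply: le_trans Tt.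
by apply: le_trans (Texit_ge eps01 fg e s); rewrite lerDl ltW// tau_gt0.
Qed.

Lemma outflow_nd (R : realType) (eps : R) (g : edge -> R -> R) e :
  flow g -> {homo outflow eps g e : a b / a <= b}.
Proof.
move=> fg a b ab; have [g0 intg _] := fg e.
by apply: le_Rint => // s /= /le_trans; exact.
Qed.

Lemma total_time_direct_ge (R : realType) (eps M tf' tf : R)
    (h : commodity -> seq edge -> R -> R) (g : edge -> R -> R) :
  0 < eps -> eps <= 1 -> 1 <= M -> feasible eps M tf' tf h g ->
  (forall w j t, walks k1 w -> w != [:: e7] -> passed eps h g k1 w j t = 0%E) ->
  (((1 + 3 * eps) * (M - 1))%:E <= total_time eps tf g)%E.
Proof.
move=> eps0 eps1 M1 fhg direct; have fg := feasible_flow fhg.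
have eps01 : 0 < eps <= 1 by rewrite eps0.
have M0 : 0 <= M by lra.
have ab : 11 <= 10 + M by lra.
apply: (@le_trans _ _ (\sum_(e <- all_edges)
    \int[leb]_(t in `[11%R, (10 + M)%R]) (cumul (g e) t - outflow eps g e t)%:E)%E); last first.
  apply: lee_sum => e _; apply: edge_time_ge => // s.
  by case: fhg => _ [/(_ e)[_ [gz _]] _]; exact: gz.
have md e : measurable_fun [set: R] (fun t => cumul (g e) t - outflow eps g e t).
  have [g0 intg _] := fg e; apply: measurable_funB.
    by apply: nondecreasing_measurable => //; exact: cumul_nd.
  by apply: nondecreasing_measurable => //; exact: outflow_nd.
rewrite -ge0_integral_sum//; last 2 first.
- by move=> e; apply/measurable_EFinP; exact: (measurable_funTS (md e)).
- by move=> e t _; rewrite lee_fin subr_ge0 outflow_le_cumul.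
apply: (@le_trans _ _ (\int[leb]_(t in `[11%R, (10 + M)%R]) (cst (1 + 3 * eps)%:E t))%E).
  rewrite integral_cst// [X in (_ * X)%E](leb_cc ab) -EFinM lee_fin.
  by rewrite ler_pM2l; lra.
apply: ge0_le_integral => //.
- by move=> t _; rewrite lee_fin addr_ge0// mulr_ge0// ltW.
- apply: emeasurable_sum => e; apply/measurable_EFinP; exact: (measurable_funTS (md e)).
- move=> t /=; rewrite in_itv/= sumEFin lee_fin => /andP[t11 tM].
  exact: (volume_present eps0 eps1 M0 fhg direct).
Qed.

(** * The detour flow *)

(** The cumulative function of a unit box on [[a, b]], that is, the length of [[a, b]] elapsed by
    [t]. *)
Definition ramp {R : realType} (a b t : R) : R := Num.max 0 (Num.min t b - a).

Section ramp.
Context {R : realType}.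
Implicit Types a b c d s t : R.

Lemma ramp_le a t b : t <= a -> ramp a b t = 0.
Proof. by move=> ta; rewrite /ramp max_l// subr_le0 ge_min ta. Qed.

Lemma ramp_mid a t b : a <= t -> t <= b -> ramp a b t = t - a.
Proof. by move=> at_ tb; rewrite /ramp min_l// max_r// subr_ge0. Qed.

Lemma ramp_ge a t b : a <= b -> b <= t -> ramp a b t = b - a.
Proof. by move=> ab bt; rewrite /ramp min_r// max_r// subr_ge0. Qed.

Lemma ramp_ge0 a t b : 0 <= ramp a b t.
Proof. by rewrite /ramp le_max lexx. Qed.

Lemma ramp_le_length a t b : a <= b -> ramp a b t <= b - a.
Proof.
by move=> ab; rewrite /ramp ge_max subr_ge0 ab lerD2r ge_min lexx orbT.
Qed.

Lemma ramp_cat a b c t : a <= b -> b <= c -> ramp a b t + ramp b c t = ramp a c t.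
Proof.
move=> ab bc; have [tb|/ltW bt] := leP t b.
  by rewrite (ramp_le c tb) addr0 /ramp !min_l//; exact: le_trans bc.
have at_ := le_trans ab bt; have ac := le_trans ab bc.
rewrite (ramp_ge ab bt); have [tc|/ltW ct] := leP t c.
  by rewrite !ramp_mid//; lra.
by rewrite !ramp_ge//; lra.
Qed.

(** The two intervals do not overlap, so the sum still has slope at most 1. It serves for e4, which
    is used over [[3 - eps, 7 - eps]] and [[9, 13 + M]]. *)
Lemma ramp_lip2 a b c d s t : a <= b -> b <= c -> s <= t ->
  ramp a b t + ramp c d t - (ramp a b s + ramp c d s) <= t - s.
Proof.
move=> ab bc st; have [tc|/ltW ct] := leP t c.
  by rewrite !(ramp_le d) ?(le_trans st tc)// !addr0; exact: ramp_lip.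
have bt := le_trans bc ct; have := ramp_lip c d ct; rewrite -!/(ramp _ _ _) (ramp_le d (lexx c)).
have [bs|/ltW sb] := leP b s.
  by rewrite (ramp_ge ab bt) (ramp_ge ab bs); have := ramp_lip c d st; rewrite -!/(ramp _ _ _) => *; lra.
have := ramp_lip a b sb; rewrite -!/(ramp _ _ _) (ramp_ge ab (lexx b)) (ramp_ge ab bt).
by rewrite (ramp_le d (le_trans sb bc)) => *; lra.
Qed.

Lemma ramp_affine (l k a b t : R) : 0 < l ->
  l * ramp a b ((t - k) / l) = ramp (l * a + k) (l * b + k) t.
Proof.
move=> l0; rewrite /ramp maxr_pMr ?ltW// mulr0 mulrBr minr_pMr ?ltW//.
rewrite mulrC divfK ?gt_eqF//; congr Num.max.
by rewrite -[X in Num.min _ X](addrK k) -addr_minl; ring.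
Qed.

End ramp.

Section boxes.
Context {R : realType}.
Implicit Types (l : seq (R * R * R)).

Definition boxes l (s : R) : R := \sum_(x <- l) box x.1.1 x.1.2 x.2 s.

Definition boxes_ok l : Prop := all (fun x => (0 <= x.1.1) && (x.1.2 <= x.2)) l.

Lemma boxes_cons x l : boxes (x :: l) = (fun s => box x.1.1 x.1.2 x.2 s + boxes l s).
Proof. by apply/funext => s; rewrite /boxes big_cons. Qed.

Lemma boxes_nil : boxes [::] = cst 0.
Proof. by apply/funext => s; rewrite /boxes big_nil. Qed.

Lemma boxes_ge0 l s : boxes_ok l -> 0 <= boxes l s.
Proof.
elim: l => [|x l IH] /=; first by rewrite boxes_nil.
by move=> /andP[/andP[x0 _] /IH l0]; rewrite boxes_cons addr_ge0// box_ge0.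
Qed.

Lemma integrable_boxes l : boxes_ok l -> leb.-integrable [set: R] (EFin \o boxes l).
Proof.
elim: l => [|x l IH] /=; first by rewrite boxes_nil => _; exact: integrable0.
move=> /andP[/andP[x0 xl] /IH il].
rewrite boxes_cons (_ : _ \o _ = ((EFin \o box x.1.1 x.1.2 x.2) \+ (EFin \o boxes l))%E)//.
by apply: integrableD => //; exact: integrable_box.
Qed.

Lemma cumul_boxes l t : boxes_ok l ->
  cumul (boxes l) t = \sum_(x <- l) x.1.1 * ramp x.1.2 x.2 t.
Proof.
elim: l => [|x l IH] /=.
  by rewrite boxes_nil big_nil => _; rewrite /cumul /Rint integral0.
move=> /andP[/andP[x0 xl] lok]; rewrite big_cons -IH// boxes_cons.
rewrite -[X in _ = X + _](cumul_box x.1.1 x.1.2 x.2 t) /cumul /Rint -fineD.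
- congr fine; rewrite -ge0_integralD//.
  + by move=> s _; rewrite lee_fin box_ge0.
  + by apply: measurable_funTS; case/integrableP : (@integrable_box R _ x.1.2 x.2 x0).
  + by move=> s _; rewrite lee_fin boxes_ge0.
  + by apply: measurable_funTS; case/integrableP : (integrable_boxes lok).
- by apply: mass_fin; [move=> s; exact: box_ge0|exact: integrable_box].
by apply: mass_fin; [move=> s; exact: boxes_ge0|exact: integrable_boxes].
Qed.

Lemma boxes_out l m n s : all (fun x => (m <= x.1.2) && (x.2 <= n)) l ->
  ~ (m <= s <= n) -> boxes l s = 0.
Proof.
elim: l => [|x l IH] /=; first by rewrite boxes_nil.
move=> /andP[/andP[mx xn] /IH out] sn; rewrite boxes_cons out// addr0 /box.
case: ifPn => // /andP[xs sx]; case: sn.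
by rewrite (le_trans mx xs) (le_trans sx xn).
Qed.

(** Stretching time by [l] divides the rate by [l]. Besides pure delays with [l = 1], the case
    [l = 3] occurs: commodity 1 enters e5 at rate 6 and leaves it at rate 2. *)
Lemma box_affine (A : R -> R) (c a b l k t : R) : 0 <= c -> a <= b -> 0 < l -> 0 <= l * a + k ->
  (forall s, a <= s -> s <= b -> A s = l * s + k) ->
  (\int[leb]_(s in [set s | (0 <= A s <= t)%R]) (box c a b s)%:E =
   (c / l * ramp (l * a + k) (l * b + k) t)%:E)%E.
Proof.
move=> c0 ab l0 lak AE.
rewrite (@eq_mass _ _ _ `]-oo, ((t - k) / l)%R]%classic).
  rewrite -EFin_Rint; [|by move=> s; exact: box_ge0|exact: integrable_box].
  rewrite -/(cumul _ _) cumul_box.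
  by congr EFin; rewrite -/(ramp _ _ _) -ramp_affine// mulrA divfK// gt_eqF.
move=> s; rewrite /box; case: ifPn => [/andP[as_ sb] _|]; last by rewrite eqxx.
rewrite /= in_itv/= AE// ler_pdivlMr// lerBrDr mulrC.
split=> [/andP[]//|->]; rewrite andbT; apply: le_trans lak _.
by rewrite lerD2r [s * l]mulrC ler_pM2l.
Qed.

End boxes.

(** The loop of commodity 1 fills e5 at three times its capacity during [[1, 2]], so commodity 2
    waits 2 there and enters e2 over [[6, 7]]. This leaves e2 to commodity 4 over [[5, 6]], which
    then uses e3 over [[6, 7]], just before commodity 3 starts. On e4 commodities 1 and 2 are
    finished before commodity 5 starts at 9. *)
Definition detour_walk (i : commodity) : seq edge :=
  match i with
  | k1 => [:: e7; e5; e4; e6] | k2 => [:: e5; e4; e2] | k3 => [:: e3]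
  | k4 => [:: e1; e2; e3] | k5 => [:: e4]
  end.

Definition detour {R : realType} (M : R) (i : commodity) (w : seq edge) (s : R) : R :=
  if w == detour_walk i then rate M i s else 0.

(* Triples (rate, start, end); on each edge they are listed in the order of
   the commodities that cause them. *)
Definition detour_boxes {R : realType} (eps M : R) (e : edge) : seq (R * R * R) :=
  match e with
  | e1 => [:: (1, 4, 5)]
  | e2 => [:: (2, 6, 7); (1, 5, 6)]
  | e3 => [:: (1, 7, 10 + M); (1, 6, 7)]
  | e4 => [:: (2, 3 - eps, 6 - eps); (2, 6 - eps, 7 - eps); (2, 9, 13 + M)]
  | e5 => [:: (6, 1, 2); (2, 2, 3)]
  | e6 => [:: (2, 3, 6)]
  | e7 => [:: (6, 0, 1)]
  end.

Section detour.
Context {R : realType} (eps M : R).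
Hypotheses (eps0 : 0 < eps) (eps1 : eps <= 1) (M0 : 0 <= M).
Let eps01 : 0 < eps <= 1. Proof. by rewrite eps0. Qed.
Ltac elra := move: (eps0) (eps1) (M0) => ? ? ?; lra.

Definition detour_inflow e := boxes (detour_boxes eps M e).
Local Notation g := detour_inflow.

Lemma detour_boxes_ok e : boxes_ok (detour_boxes eps M e).
Proof.
rewrite /boxes_ok; case: e => /=; rewrite ?andbT; repeat (apply/andP; split); elra.
Qed.

Lemma detour_boxes_within e n : 13 + M <= n ->
  all (fun x => (0 <= x.1.2) && (x.2 <= n)) (detour_boxes eps M e).
Proof.
by move=> nM; case: e => /=; rewrite ?andbT; repeat (apply/andP; split); elra.
Qed.

Lemma detour_inflow_out e s n : 13 + M <= n -> ~ (0 <= s <= n) -> g e s = 0.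
Proof. by move=> nM; apply: boxes_out; exact: detour_boxes_within. Qed.

Lemma detour_inflow_flow : flow g.
Proof.
move=> e; split.
- by move=> s; exact/boxes_ge0/detour_boxes_ok.
- exact/integrable_boxes/detour_boxes_ok.
move=> s s0; apply: (detour_inflow_out e (lexx _)) => /andP[].
by rewrite leNgt s0.
Qed.
Let fg := detour_inflow_flow.

Lemma cumul_detour e t : cumul (g e) t =
  \sum_(x <- detour_boxes eps M e) x.1.1 * ramp x.1.2 x.2 t.
Proof. exact/cumul_boxes/detour_boxes_ok. Qed.

Lemma detour_exit1 t : Texit eps g e1 t = t + 1.
Proof.
rewrite (Texit_noqueue eps01 fg (n := 1))// => s st.
by rewrite !cumul_detour !big_cons !big_nil/= !addr0 !mul1r; exact: ramp_lip.
Qed.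

Lemma detour_exit7 t : Texit eps g e7 t = t + 1.
Proof.
rewrite (Texit_noqueue eps01 fg (n := 6))// => s st.
by rewrite !cumul_detour !big_cons !big_nil/= !addr0 -mulrBr ler_pM2l//; exact: ramp_lip.
Qed.

Lemma detour_exit3 t : Texit eps g e3 t = t + eps.
Proof.
rewrite (Texit_noqueue eps01 fg (n := 1))// => s st.
rewrite !cumul_detour !big_cons !big_nil/= !addr0 !mul1r.
have M7 : 7 <= 10 + M :> R by elra.
have := @ramp_lip R 6 (10 + M) s t st; rewrite -!/(ramp _ _ _).
by rewrite -!(@ramp_cat R 6 7 (10 + M))//; [|lra..] => ?; lra.
Qed.

Lemma detour_exit4 t : Texit eps g e4 t = t + eps.
Proof.
rewrite (Texit_noqueue eps01 fg (n := 2))// => s st.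
rewrite !cumul_detour !big_cons !big_nil/= !addr0 -!mulrDr -mulrBr ler_pM2l// !addrA.
rewrite !ramp_cat; [|elra..].
by apply: ramp_lip2 => //; elra.
Qed.

(** This covers commodity 4, which enters e2 over [[5, 6]]. Afterwards commodity 2 overloads e2, but
    it delays only itself. *)
Lemma detour_exit2 t : t <= 6 -> Texit eps g e2 t = t + 1.
Proof.
move=> t6; rewrite (Texit_noqueue eps01 fg (n := 1))// => s st.
have s6 := le_trans st t6.
rewrite !cumul_detour !big_cons !big_nil/= !addr0 !mul1r !(ramp_le 7)// mulr0 !add0r.
exact: ramp_lip.
Qed.

(** During [[1, 2]] the inflow exceeds the capacity by [6 - 2 = 4]; during [[2, 3]] it equals the
    capacity and the queue stays at 4. *)
Lemma queue5_le t : queue (g e5) 2 t <= 4 * ramp 1 2 t.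
Proof.
apply: queue_le => s st.
rewrite !cumul_detour !big_cons !big_nil/= !addr0.
have := @ramp_lip R 1 3 s t st; rewrite -!/(ramp _ _ _).
rewrite -!(@ramp_cat R 1 2 3)//; [|lra..].
by have := ramp_ge0 1 s 2; lra.
Qed.

Lemma queue5_ge t : 1 <= t -> 6 * ramp 1 2 t + 2 * ramp 2 3 t - 2 * (t - 1) <= queue (g e5) 2 t.
Proof.
move=> t1; have [g0 intg _] := fg e5.
apply: le_trans (queue_ub g0 intg (_ : 0 < 2) t1) => //.
rewrite !cumul_detour !big_cons !big_nil/= !addr0.
by rewrite (ramp_le 2 (lexx 1)) (@ramp_le _ 2 1 3); lra.
Qed.

Lemma detour_exit5_12 t : 1 <= t -> t <= 2 -> Texit eps g e5 t = 3 * t - eps.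
Proof.
move=> t1 t2; rewrite (TexitE eps01 fg (n := 2))// /exit_time/=.
have := queue5_ge t1; have := queue5_le t.
by rewrite (ramp_le 3 t2) (ramp_mid t1 t2) => ? ?; lra.
Qed.

Lemma detour_exit5_23 t : 2 <= t -> t <= 3 -> Texit eps g e5 t = t + (4 - eps).
Proof.
move=> t2 t3; rewrite (TexitE eps01 fg (n := 2))// /exit_time/=.
have t1 : 1 <= t by lra.
have := queue5_ge t1; have := queue5_le t.
by rewrite (ramp_mid t2 t3) (@ramp_ge _ 1 t 2)//; [|lra] => ? ?; lra.
Qed.

Lemma detour_time5 t : Dtime eps g e5 t <= 4.
Proof.
have [g0 intg gneg] := fg e5.
rewrite (@DtimeE _ _ _ _ 2)//=; last by elra.
by have := queue5_le t; have := @ramp_le_length R 1 t 2; elra.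
Qed.

Lemma detour_time2 t : Dtime eps g e2 t <= 2.
Proof.
have [g0 intg gneg] := fg e2.
rewrite (@DtimeE _ _ _ _ 1)//=.
suff : queue (g e2) 1 t <= 1 by lra.
apply: queue_le => s st.
rewrite !cumul_detour !big_cons !big_nil/= !addr0.
have := @ramp_lip R 5 7 s t st; rewrite -!/(ramp _ _ _).
rewrite -!(@ramp_cat R 5 6 7)//; [|lra..].
have := ramp_ge0 6 s 7; have := @ramp_le_length R 6 t 7.
by move=> ? ? ?; lra.
Qed.

End detour.

(** * Feasibility and cost of the detour flow *)

Section detour_feasible.
Context {R : realType} (eps M tf' tf : R).
Hypotheses (eps0 : 0 < eps) (eps1 : eps <= 1) (M0 : 0 <= M)
  (tf'M : 13 + M <= tf') (tf'tf : tf' <= tf).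
Let eps01 : 0 < eps <= 1. Proof. by rewrite eps0. Qed.
Ltac elra := move: (eps0) (eps1) (M0) (tf'M) (tf'tf) => ? ? ? ? ?; lra.
Local Notation g := (detour_inflow eps M).
Let fg := detour_inflow_flow eps0 eps1 M0.

Lemma detour_walkP i : walks i (detour_walk i).
Proof. by case: i. Qed.

Lemma rate_out i s : ~ (0 <= s <= tf) -> rate M i s = 0.
Proof.
move=> sn; case: i => /=; case: ifPn => // /andP[? ?].
all: by case: sn; apply/andP; split; elra.
Qed.

Lemma detour_walk_flow_ok : walk_flow_ok M tf (detour M).
Proof.
split; [|split].
- move=> i w _; split; [|split].
  + by move=> s; rewrite /detour; case: ifP => _ //; exact: rate_ge0.
  + by move=> s sn; rewrite /detour; case: ifP => _ //; exact: rate_out.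
  rewrite /detour; case: (w == _); first exact: integrable_rate.
  exact: integrable0.
- move=> i w wi s; rewrite /detour; case: eqP => // wE.
  by case: wi; rewrite inE wE; exact: detour_walkP.
move=> i; apply: (aeS (P := xpredT)); last first.
  by apply: (negligibleS _ (negligible_set0 _)) => s /=.
move=> s _; rewrite -[RHS](esum_pick (detour_walkP i)) ?lee_fin ?rate_ge0//.
by apply: eq_esum => w _; rewrite /detour; case: eqP.
Qed.

Lemma detour_term (i : commodity) (e : edge) (t : R) :
  (\esum_(w in walks i) \sum_(j < size w | nth e1 w j == e)
     \int[leb]_(s in [set s : R | (0 <= arr eps g w j s <= t)%R]) (detour M i w s)%:E =
   \sum_(j < size (detour_walk i) | nth e1 (detour_walk i) j == e)
     \int[leb]_(s in [set s : R | (0 <= arr eps g (detour_walk i) j s <= t)%R])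
       (rate M i s)%:E)%E.
Proof.
rewrite -[RHS](esum_pick (detour_walkP i)); last first.
  apply: sume_ge0 => j _; apply: mass_ge0; exact: rate_ge0.
apply: eq_esum => w _; have [->|wi] := eqVneq w (detour_walk i).
  by apply: eq_bigr => j _; rewrite /detour eqxx.
by rewrite big1// => j _; rewrite /detour (negbTE wi) integral0.
Qed.

Lemma detour_induces : induces eps (detour M) g.
Proof.
move=> e t; have [g0 intg gneg] := fg e.
transitivity (cumul (g e) t)%:E.
  by rewrite -(cumul_Icc gneg) EFin_Rint.
under eq_bigr do rewrite detour_term.
(* On the departure interval of each commodity every arrival time is affine. The parameters [c'],
   [a'], [b'] are those listed in [detour_boxes], tied to the affine map by equations that linear
   arithmetic settles. *)
have affine i j (c a b l k c' a' b' : R) : rate M i = box c a b -> 0 <= c -> a <= b ->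
    0 < l -> 0 <= a' -> c = c' * l -> a' = l * a + k -> b' = l * b + k ->
    (forall s, a <= s -> s <= b -> arr eps g (detour_walk i) j s = l * s + k) ->
    (\int[leb]_(s in [set s : R | (0 <= arr eps g (detour_walk i) j s <= t)%R])
       (rate M i s)%:E)%E = (c' * ramp a' b' t)%:E.
  move=> -> c0 ab l0 a'0 cE a'E b'E AE; rewrite a'E in a'0.
  by rewrite (box_affine t c0 ab l0 a'0 AE) cE a'E b'E mulfK// gt_eqF.
pose Z i j := (\int[leb]_(s in [set s : R | (0 <= arr eps g (detour_walk i) j s <= t)%R])
  (rate M i s)%:E)%E.
have Z1 : [/\ Z k1 0%N = (6 * ramp 0 1 t)%:E,
    Z k1 1%N = (6 * ramp 1 2 t)%:E,
    Z k1 2%N = (2 * ramp (3 - eps) (6 - eps) t)%:E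
    & Z k1 3%N = (2 * ramp 3 6 t)%:E].
  split.
  - apply: (affine _ _ 6 0 1 1 0) => //; try lra.
    by move=> s _ _; rewrite /arr/=; lra.
  - apply: (affine _ _ 6 0 1 1 1) => //; try lra.
    by move=> s _ _; rewrite /arr/= (detour_exit7 eps0 eps1 M0); lra.
  - apply: (affine _ _ 6 0 1 3 (3 - eps)) => //; try elra.
    move=> s s0 s1; rewrite /arr/= (detour_exit7 eps0 eps1 M0).
    by rewrite (detour_exit5_12 eps0 eps1 M0); lra.
  - apply: (affine _ _ 6 0 1 3 3) => //; try lra.
    move=> s s0 s1; rewrite /arr/= (detour_exit7 eps0 eps1 M0) (detour_exit4 eps0 eps1 M0).
    by rewrite (detour_exit5_12 eps0 eps1 M0); lra.
have Z2 : [/\ Z k2 0%N = (2 * ramp 2 3 t)%:E,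
    Z k2 1%N = (2 * ramp (6 - eps) (7 - eps) t)%:E
    & Z k2 2%N = (2 * ramp 6 7 t)%:E].
  split.
  - apply: (affine _ _ 2 2 3 1 0) => //; try lra.
    by move=> s _ _; rewrite /arr/=; lra.
  - apply: (affine _ _ 2 2 3 1 (4 - eps)) => //; try elra.
    by move=> s s2 s3; rewrite /arr/= (detour_exit5_23 eps0 eps1 M0)//; lra.
  - apply: (affine _ _ 2 2 3 1 4) => //; try elra.
    move=> s s2 s3; rewrite /arr/= (detour_exit4 eps0 eps1 M0).
    by rewrite (detour_exit5_23 eps0 eps1 M0)//; lra.
have Z4 : [/\ Z k4 0%N = (1 * ramp 4 5 t)%:E,
    Z k4 1%N = (1 * ramp 5 6 t)%:E
    & Z k4 2%N = (1 * ramp 6 7 t)%:E].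
  split.
  - apply: (affine _ _ 1 4 5 1 0) => //; try elra.
    by move=> s _ _; rewrite /arr/=; lra.
  - apply: (affine _ _ 1 4 5 1 1) => //; try elra.
    by move=> s _ _; rewrite /arr/= (detour_exit1 eps0 eps1 M0); lra.
  - apply: (affine _ _ 1 4 5 1 2) => //; try elra.
    move=> s s4 s5; rewrite /arr/= (detour_exit1 eps0 eps1 M0).
    by rewrite (detour_exit2 eps0 eps1 M0); lra.
have Z35 : Z k3 0%N = (1 * ramp 7 (10 + M) t)%:E /\ Z k5 0%N = (2 * ramp 9 (13 + M) t)%:E.
  split.
  - apply: (affine _ _ 1 7 (10 + M) 1 0) => //; try elra.
    by move=> s _ _; rewrite /arr/=; lra.
  - apply: (affine _ _ 2 9 (13 + M) 1 0) => //; try elra.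
    by move=> s _ _; rewrite /arr/=; lra.
rewrite (cumul_detour eps0 eps1 M0) -sumEFin.
transitivity (\sum_(i <- all_commodities)
    \sum_(j < size (detour_walk i) | nth e1 (detour_walk i) j == e) Z i j)%E => //.
case: Z1 => Z10 Z11 Z12 Z13; case: Z2 => Z20 Z21 Z22; case: Z35 => Z30 Z50.
case: Z4 => Z40 Z41 Z42.
under [RHS]eq_bigr do rewrite big_mkcond.
rewrite ![in RHS]big_cons [in RHS]big_nil /= !big_ord_recl !big_ord0 /=.
rewrite Z10 Z11 Z12 Z13 Z20 Z21 Z22 Z30 Z40 Z41 Z42 Z50.
by case: e {g0 intg gneg} => /=; rewrite !big_cons big_nil /= ?add0e ?adde0.
Qed.

Lemma detour_feasible : feasible eps M tf' tf (detour M) g.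
Proof.
split; first exact: detour_walk_flow_ok.
split; last split; last exact: detour_induces.
- move=> e; have [g0 intg gneg] := fg e; split=> //; split=> // s.
  by apply: (detour_inflow_out eps0 eps1 M0); elra.
- by move=> e s; apply: (detour_inflow_out eps0 eps1 M0).
Qed.

Lemma edge_time_le e (d c : R) : 0 <= d -> (forall s, Dtime eps g e s <= d) ->
  \sum_(x <- detour_boxes eps M e) x.1.1 * (x.2 - x.1.2) = c ->
  (\int[leb]_(s in [set s : R | (0 <= s <= tf)%R]) (Dtime eps g e s * g e s)%:E <=
   (d * c)%:E)%E.
Proof.
move=> d0 Dd <-; have [g0 intg gneg] := fg e.
have mset : measurable [set s : R | (0 <= s <= tf)%R].
  by rewrite -set_itvcc; exact: measurable_itv.
apply: (@le_trans _ _ (\int[leb]_(s in [set s : R | (0 <= s <= tf)%R]) (d%:E * (g e s)%:E))%E).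
  have mg := integrable_measurable_fun intg.
  apply: ge0_le_integral => //.
  - move=> s _; rewrite lee_fin mulr_ge0//; have := Texit_ge eps01 fg e s.
    by rewrite /Texit lerD2l; apply: le_trans; exact: ltW (tau_gt0 eps01 e).
  - apply/measurable_EFinP/measurable_funTS; apply: measurable_funM => //.
    rewrite (_ : Dtime _ _ _ = (fun s => Texit eps g e s - s)).
      by apply: measurable_funB => //; exact: measurable_Texit.
    by apply/funext => s; rewrite /Texit addrC addKr.
  - rewrite (_ : (fun _ => _) = EFin \o (fun s => d * g e s))//.
    by apply/measurable_EFinP/measurable_funTS; exact: measurable_funM.
  - by move=> s _; rewrite -EFinM lee_fin ler_wpM2r.
rewrite ge0_integralZl_EFin//; last 2 first.
- by move=> s _; rewrite lee_fin.
- by apply/measurable_EFinP/measurable_funTS; exact: integrable_measurable_fun.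
rewrite -EFin_Rint// -EFinM lee_fin cumul_Icc// ler_wpM2l//.
rewrite cumul_detour//; have /allP ok := detour_boxes_ok eps0 eps1 M0 e.
rewrite big_seq [leRHS]big_seq; apply: ler_sum => x /ok /andP[x0 xx].
by rewrite ler_wpM2l// ramp_le_length.
Qed.

Lemma detour_total_time : (total_time eps tf g <= (69 + 20 * eps + 3 * eps * M)%:E)%E.
Proof.
have D e s x : Texit eps g e s = s + x -> Dtime eps g e s = x.
  by move=> Te; apply: (@addrI _ s).
rewrite /total_time /all_edges !big_cons big_nil.
(* One summand per edge from e1 to e7, each a bound on the traversal time multiplied by the total
   volume entering that edge. *)
apply: (@le_trans _ _ (1 * 1 + (2 * 3 + (eps * (4 + M) + (eps * (16 + 2 * M) +
  (4 * 8 + (4 * 6 + (1 * 6 + 0)))))))%:E); last by rewrite lee_fin; lra.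
rewrite !EFinD; repeat apply: leeD.
- by apply: edge_time_le => // [s|]; [rewrite (D _ _ _ (detour_exit1 _ _ _ _))
    | rewrite /= !big_cons big_nil/=; elra].
- apply: edge_time_le => // [s|]; first exact: detour_time2.
  by rewrite /= !big_cons big_nil/=; elra.
- apply: edge_time_le => [|s|]; first exact: ltW.
    by rewrite (D _ _ _ (detour_exit3 _ _ _ _)).
  by rewrite /= !big_cons big_nil/=; elra.
- apply: edge_time_le => [|s|]; first exact: ltW.
    by rewrite (D _ _ _ (detour_exit4 _ _ _ _)).
  by rewrite /= !big_cons big_nil/=; elra.
- apply: edge_time_le => // [s|]; first exact: detour_time5.
  by rewrite /= !big_cons big_nil/=; elra.
- apply: edge_time_le => // [s|]; first by rewrite (D _ _ _ (Texit6 _ _ _)).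
  by rewrite /= !big_cons big_nil/=; elra.
- apply: edge_time_le => // [s|]; first by rewrite (D _ _ _ (detour_exit7 _ _ _ _)).
  by rewrite /= !big_cons big_nil/=; elra.
by [].
Qed.

End detour_feasible.

(** * Comparison of the two bounds *)

Theorem theorem3p2 (R : realType) :
  exists M : R, 0 <= M /\
  exists T0 : R,
    forall eps tf' tf : R,
      0 < eps <= 1 -> T0 <= tf' -> tf' <= tf ->
      ~ (exists g : edge -> R -> R,
            system_optimal eps M tf' tf g /\ implementable eps M tf' tf g).
Proof.
(* In [(1 + 3 * eps) * (M - 1) > 69 + 20 * eps + 3 * eps * M] the terms [3 * eps * M] cancel,
   leaving [M > 70 + 23 * eps]; every [M > 93] satisfies it for all [eps <= 1]. The horizon 113 is
   [13 + M], the end of the last inflow into an edge in the detour flow. *)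
exists 100; split=> //; exists 113 => eps tf' tf eps01 T0tf' tf'tf.
have /andP[eps0 eps1] := eps01.
have M0 : 0 <= 100 :> R by [].
have T0 : 13 + 100 <= tf' by lra.
move=> [g [[_ opt] [p [p0 [h [fhg [due _]]]]]]].
have direct w j t := DUE_direct (w := w) eps01 fhg j t p0 due.
have M1 : 1 <= 100 :> R by rewrite ler1n.
have lower := total_time_direct_ge eps0 eps1 M1 fhg direct.
have feas : in_image eps 100 tf' tf (detour_inflow eps 100).
  by exists (detour 100); exact: detour_feasible.
have := le_trans lower (le_trans (opt _ feas) (detour_total_time eps0 eps1 M0 T0 tf'tf)).
by rewrite lee_fin; lra.
Qed.
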